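(* For every fixed $\delta>0$ and every integer $t$ that is sufficiently large with respect to $\delta$, there is a graph $G$ with $\chi(G)\geq (\frac32-\delta)t$ which does not have $K_t$ as an odd minor. In particular, for every sufficiently large integer $t$, there is a graph $G$ with $\chi(G)\geq t$ which does not have $K_t$ as an odd minor.
   Context: All graphs are finite and simple; $\chi(G)$ denotes the chromatic number. A graph $G$ has $K_t$ as an odd minor if there exist vertex-disjoint trees $T_1,\dots,T_t\subseteq G$ and functions $\chi_i:V(T_i)\to\{\text{black},\text{white}\}$ such that (i) for every $i$, $\chi_i$ is a proper $2$-coloring of $T_i$ (i.e. $\chi_i(x)\neq\chi_i(y)$ for every edge $\{x,y\}\in E(T_i)$), and (ii) for all $i\neq j$ there are vertices $x_i\in V(T_i)$, $x_j\in V(T_j)$ with $\{x_i,x_j\}\in E(G)$ and $\chi_i(x_i)=\chi_j(x_j)$. *)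

(* Defs.v *)
From HB Require Import structures.
From mathcomp Require Import all_boot all_order all_algebra.
From mathcomp Require Import reals.
Set Implicit Arguments. Unset Strict Implicit. Unset Printing Implicit Defensive.
Import Order.TTheory GRing.Theory Num.Theory.

Section Graphs.
Variable T : finType.

Definition simple_graph (e : rel T) : Prop := symmetric e /\ irreflexive e.

(* Proper colouring with k colours (boolean, so it can be minimised). *)
Definition colorableb (e : rel T) (k : nat) : bool :=
  [exists f : {ffun T -> 'I_k}, [forall x, forall y, e x y ==> (f x != f y)]].

Lemma colorable_card (e : rel T) : simple_graph e -> colorableb e #|T|.
Proof.
move=> [_ irr]; apply/existsP; exists [ffun x => enum_rank x].
apply/forallP=> x; apply/forallP=> y; apply/implyP=> exy.
rewrite !ffunE; apply/negP=> /eqP/enum_rank_inj exy'.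
by rewrite exy' irr in exy.
Qed.

(* Chromatic number: least k admitting a proper k-colouring
   (#|T| if e is not a simple graph — never used in that case). *)
Definition chromatic_number (e : rel T) : nat :=
  match boolP (colorableb e #|T|) with
  | AltTrue h => ex_minn (ex_intro (fun k => colorableb e k) _ h)
  | AltFalse _ => #|T|
  end.

Definition is_tree (V : {set T}) (f : rel T) : Prop :=
  [/\ V != set0,
      symmetric f,
      (forall x y, f x y -> (x \in V) && (y \in V)),
      {in V &, forall x y, connect f x y} &
      (forall s : seq T, uniq s -> 2 < size s -> ~~ cycle f s)].

Definition has_odd_minor_K (e : rel T) (t : nat) : Prop :=
  exists (V : 'I_t -> {set T}) (F : 'I_t -> rel T) (c : 'I_t -> T -> bool),
    [/\ (forall i j, i != j -> [disjoint V i & V j]),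
        (forall i, is_tree (V i) (F i)),
        (forall i x y, F i x y -> e x y),
        (forall i x y, F i x y -> c i x != c i y) &
        (forall i j, i != j ->
           exists x y, [/\ x \in V i, y \in V j, e x y & c i x = c j y])].

End Graphs.

(* Main.v *)
Require Import Defs.
From mathcomp Require Import all_boot all_order all_algebra all_field.
From mathcomp Require Import reals ring lra zify.
Import Order.TTheory GRing.Theory Num.Theory.
Set Implicit Arguments. Unset Strict Implicit. Unset Printing Implicit Defensive.

(* If G is the complement of a triangle-free graph H on n vertices, then chi(G) >= n/2. An odd K_t minor with t slightly larger than n/3 has linearly many bags of size at most 2, hence linearly many disjoint pairs (b_i, w_i) such that b_i b_j and w_i w_j are never both edges of H. So it suffices to find a triangle-free H with no such family of epsilon n pairs.

H is a random sample of n vertices of a triangle-free graph A of density p = 1/(2q). The vertices of A are the points of F_q^4, equipped with random signs; two points are adjacent when their difference is isotropic for an elliptic quadratic form and their signs in its direction differ. The nontrivial eigenvalues of A are very asymmetric: relative to the degree they lie between about -1/q and 1/q^2, so in the tensor square of A their products are far below p^2 in absolute value. Hence every set of q^(-3) |A|^2 pairs with balanced marginals spans about the expected number of edges of the tensor square, and a container argument shows that, for q^2 << n << q^3 up to logarithms, with positive probability the random sample has no such family. *)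

(** * Tensor products of quadratic forms *)

Section QuadraticForms.
Local Open Scope ring_scope.
Variable R : realFieldType.

Definition qform (T : finType) (Y : T -> T -> R) (f : T -> R) : R :=
  \sum_x \sum_y f x * Y x y * f y.

Definition psd (T : finType) (Y : T -> T -> R) : Prop :=
  (forall x y, Y x y = Y y x) /\ (forall f, 0 <= qform Y f).

Lemma sum_indicator (T : finType) (x : T) (h : T -> R) :
  \sum_y (y == x)%:R * h y = h x.
Proof.
rewrite (bigD1 x) //= eqxx mul1r big1 ?addr0 // => y /negPf ->.
by rewrite mul0r.
Qed.

Lemma qform_shift (T : finType) (Y : T -> T -> R) (g : T -> R) (a : R) (x : T) :
  (forall u v, Y u v = Y v u) ->
  qform Y (fun z => g z + a * (z == x)%:R) =
  qform Y g + 2 * a * (\sum_z Y x z * g z) + a ^+ 2 * Y x x.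
Proof.
move=> symY; rewrite /qform.
under eq_bigr => u _.
  under eq_bigr => v _.
    rewrite (_ : _ * _ = g u * Y u v * g v + (v == x)%:R * (a * g u * Y u v)
      + (u == x)%:R * (a * (Y u v * g v)) +
      (u == x)%:R * ((v == x)%:R * (a ^+ 2 * Y u v))); last by ring.
    over.
  rewrite !big_split /= -!big_distrr /= !sum_indicator.
  over.
rewrite !big_split /= !sum_indicator.
have -> : \sum_u a * g u * Y u x = a * \sum_z Y x z * g z.
  by rewrite big_distrr; apply: eq_bigr => z _ /=; rewrite (symY z x); ring.
ring.
Qed.

(** With [Y x x = 0] the form is affine in the coefficient of [x], so a nonzero [Y x y] would let it
    take negative values. *)
Lemma psd_diag0 (T : finType) (Y : T -> T -> R) x y :
  psd Y -> Y x x = 0 -> Y x y = 0.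
Proof.
move=> [symY posY] Yxx; apply/eqP; apply: contraT => Yxy.
(* The coefficient is chosen to make the value exactly -1. *)
have := posY (fun z => (z == y)%:R + (- (Y y y + 1) / (2 * Y x y)) * (z == x)%:R).
rewrite qform_shift // Yxx mulr0 addr0.
have -> : qform Y (fun z => (z == y)%:R) = Y y y.
  rewrite /qform; under eq_bigr => u _.
    under eq_bigr => v _ do rewrite mulrC.
    rewrite sum_indicator; over.
  by rewrite sum_indicator.
under eq_bigr => z _ do rewrite mulrC.
rewrite sum_indicator.
have -> : Y y y + 2 * (- (Y y y + 1) / (2 * Y x y)) * Y x y = -1 by field.
by rewrite oppr_ge0 ler10.
Qed.

(** The quadratic form of the Kronecker product of [Y] and [Z], with [u] read as a vector indexed by
    pairs. *)
Definition tensor_form (T1 T2 : finType) (Y : T1 -> T1 -> R) (Z : T2 -> T2 -> R)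
    (u : T1 -> T2 -> R) : R :=
  \sum_x \sum_x' \sum_y \sum_y' u x y * Y x x' * Z y y' * u x' y'.

Lemma tensor_formDl (T1 T2 : finType) (Y Y' : T1 -> T1 -> R)
    (Z : T2 -> T2 -> R) a b u :
  tensor_form (fun x y => a * Y x y + b * Y' x y) Z u =
  a * tensor_form Y Z u + b * tensor_form Y' Z u.
Proof.
rewrite /tensor_form !big_distrr -big_split; apply: eq_bigr => x _ /=.
rewrite !big_distrr -big_split; apply: eq_bigr => x' _ /=.
rewrite !big_distrr -big_split; apply: eq_bigr => y _ /=.
rewrite !big_distrr -big_split; apply: eq_bigr => y' _ /=.
ring.
Qed.

Lemma tensor_formDr (T1 T2 : finType) (Y : T1 -> T1 -> R)
    (Z Z' : T2 -> T2 -> R) a b u :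
  tensor_form Y (fun x y => a * Z x y + b * Z' x y) u =
  a * tensor_form Y Z u + b * tensor_form Y Z' u.
Proof.
rewrite /tensor_form !big_distrr -big_split; apply: eq_bigr => x _ /=.
rewrite !big_distrr -big_split; apply: eq_bigr => x' _ /=.
rewrite !big_distrr -big_split; apply: eq_bigr => y _ /=.
rewrite !big_distrr -big_split; apply: eq_bigr => y' _ /=.
ring.
Qed.

Lemma eq_tensor_form (T1 T2 : finType) (Y Y' : T1 -> T1 -> R)
    (Z Z' : T2 -> T2 -> R) u :
  Y =2 Y' -> Z =2 Z' -> tensor_form Y Z u = tensor_form Y' Z' u.
Proof.
move=> eY eZ; do 4![apply: eq_bigr => ? _]; by rewrite eY eZ.
Qed.

Lemma tensor_form_rank1 (T1 T2 : finType) (g : T1 -> R) (Z : T2 -> T2 -> R) u :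
  tensor_form (fun x x' => g x * g x') Z u =
  qform Z (fun y => \sum_x g x * u x y).
Proof.
rewrite /tensor_form /qform.
under eq_bigr => x _ do rewrite exchange_big.
rewrite exchange_big; apply: eq_bigr => y _ /=.
under eq_bigr => x _ do rewrite exchange_big.
rewrite exchange_big; apply: eq_bigr => y' _ /=.
rewrite -mulrA big_distrl; apply: eq_bigr => x _ /=.
rewrite mulrA big_distrr; apply: eq_bigr => x' _ /=.
ring.
Qed.

(* Gaussian elimination: subtracting the rank-one form of a nonzero pivot leaves a positive semidefinite form with one more zero row. *)
Lemma psd_tensor (T1 T2 : finType) (Y : T1 -> T1 -> R) (Z : T2 -> T2 -> R) u :
  psd Y -> psd Z -> 0 <= tensor_form Y Z u.
Proof.
move=> psdY psdZ; have [n] := ubnP #|[set x | Y x x != 0]|.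
elim: n => // n IHn in Y psdY *; rewrite ltnS => ltYn.
have [/existsP[t Ytt]|noD] := boolP [exists t, Y t t != 0]; last first.
  rewrite /tensor_form big1 // => x _; rewrite big1 // => x' _.
  rewrite big1 // => y _; rewrite big1 // => y' _.
  suff -> : Y x x' = 0 by rewrite mulr0 !mul0r.
  apply: psd_diag0 => //; apply/eqP; apply: contraT => Yxx.
  by case/negP: noD; apply/existsP; exists x.
have [symY posY] := psdY.
have Yt0 : 0 < Y t t.
  rewrite lt_def Ytt /=; have := posY (fun z => 0 + 1 * (z == t)%:R).
  rewrite qform_shift // big1 ?mulr0 ?addr0; last by move=> ? _; rewrite mulr0.
  rewrite expr1n mul1r /qform big1 ?add0r // => x _.
  by rewrite big1 // => y _; rewrite mulr0.
pose Y' x x' := Y x x' - (Y t t)^-1 * (Y t x * Y t x').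
have -> : tensor_form Y Z u = 1 * tensor_form Y' Z u +
    (Y t t)^-1 * tensor_form (fun x x' => Y t x * Y t x') Z u.
  by rewrite -tensor_formDl; apply: eq_tensor_form => // x x'; rewrite /Y'; ring.
rewrite tensor_form_rank1 mul1r addr_ge0 //; last first.
  by rewrite mulr_ge0 ?invr_ge0 ?(ltW Yt0) //; case: psdZ.
have psdY' : psd Y'.
  split=> [x y|f]; first by rewrite /Y' (symY x y); ring.
  pose l := \sum_z Y t z * f z.
  have -> : qform Y' f = qform Y f - (Y t t)^-1 * l ^+ 2.
    rewrite expr2 /qform {1}/l big_distrl big_distrr -sumrB.
    apply: eq_bigr => x _ /=; rewrite /l !big_distrr -sumrB.
    by apply: eq_bigr => y _ /=; rewrite /Y'; ring.
  (* This shift minimises [qform Y] along the coordinate [t], and the minimum is [qform Y' f]. *)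
  have := posY (fun z => f z + (- l / Y t t) * (z == t)%:R).
  rewrite qform_shift // -/l.
  by rewrite (_ : _ + _ + _ = qform Y f - (Y t t)^-1 * l ^+ 2); last by field.
apply: IHn => //; apply: leq_trans ltYn; apply: proper_card.
apply/properP; split.
  apply/subsetP=> x; rewrite !inE; apply: contra_neq => Yxx.
  by rewrite /Y' Yxx (symY t x) (psd_diag0 t psdY Yxx) mul0r mulr0 subr0.
by exists t; rewrite inE ?Ytt // /Y' negbK; apply/eqP; field.
Qed.

(** Both [X + a I] and [b I - X] are positive semidefinite, hence so are their tensor squares.
    Adding these with weights [b] and [a] cancels the mixed terms. The constant is the product
    [a * b], which is where an asymmetric spectrum gains. *)
Lemma tensor_form_ge (T : finType) (X : T -> T -> R) (a b : R) u :
  0 < a -> 0 < b -> (forall x y, X x y = X y x) ->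
  (forall f, - a * \sum_x f x ^+ 2 <= qform X f) ->
  (forall f, qform X f <= b * \sum_x f x ^+ 2) ->
  - (a * b) * (\sum_x \sum_y u x y ^+ 2) <= tensor_form X X u.
Proof.
move=> a0 b0 symX loX upX.
pose I (x y : T) : R := (x == y)%:R.
have symI x y : I x y = I y x by rewrite /I eq_sym.
have qI f : qform I f = \sum_x f x ^+ 2.
  apply: eq_bigr => x _; rewrite expr2.
  under eq_bigr => y _.
    rewrite (_ : _ * _ = (y == x)%:R * (f x * f y)); last first.
      by rewrite /I (eq_sym x); ring.
    over.
  by rewrite sum_indicator.
have qD Y Z c d f : qform (fun x y => c * Y x y + d * Z x y) f =
    c * qform Y f + d * qform Z f.
  rewrite /qform !big_distrr -big_split; apply: eq_bigr => x _ /=.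
  rewrite !big_distrr -big_split; apply: eq_bigr => y _ /=; ring.
have psd1 : psd (fun x y => 1 * X x y + a * I x y).
  split=> [x y|f]; first by rewrite symX symI.
  by rewrite qD qI mul1r -lerBlDr sub0r -mulNr.
have psd2 : psd (fun x y => -1 * X x y + b * I x y).
  split=> [x y|f]; first by rewrite symX symI.
  by rewrite qD qI mulN1r addrC subr_ge0.
have := psd_tensor u psd1 psd1; have := psd_tensor u psd2 psd2.
rewrite !(tensor_formDl, tensor_formDr).
have -> : tensor_form I I u = \sum_x \sum_y u x y ^+ 2.
  apply: eq_bigr => x _; rewrite exchange_big; apply: eq_bigr => y _ /=.
  under eq_bigr => x' _.
    under eq_bigr => y' _.
      rewrite (_ : _ * _ = (y' == y)%:R * ((x' == x)%:R * (u x y * u x' y'))); last first.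
        by rewrite /I (eq_sym x) (eq_sym y); ring.
      over.
    rewrite sum_indicator; over.
  by rewrite sum_indicator expr2.
set p := \sum_x _; set s := tensor_form X X u.
set v := tensor_form X I u; set w := tensor_form I X u => h2 h1.
have g1 := mulr_ge0 (ltW b0) h1; have g2 := mulr_ge0 (ltW a0) h2.
have ab : 0 < a + b by rewrite addr_gt0.
suff h : 0 <= (a + b) * (s + a * b * p).
  by move: h; rewrite pmulr_rge0 // => h; lra.
by apply: le_trans (addr_ge0 g1 g2) _; rewrite le_eqVlt; apply/orP; left; apply/eqP; ring.
Qed.

(** Split [A] as [X] plus [p] times the all-ones kernel. The mixed terms of the tensor square are
    forms of [X] at the row and column sums of [u], bounded below through [a]. *)
Lemma tensor_form_mean_ge (T : finType) (A : T -> T -> R) (p a b : R) u :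
  0 <= p -> 0 < a -> 0 < b -> (forall x y, A x y = A y x) ->
  (forall f, p * (\sum_x f x) ^+ 2 - a * \sum_x f x ^+ 2 <= qform A f) ->
  (forall f, qform A f <= p * (\sum_x f x) ^+ 2 + b * \sum_x f x ^+ 2) ->
  p ^+ 2 * (\sum_x \sum_y u x y) ^+ 2
  - p * a * (\sum_x (\sum_y u x y) ^+ 2 + \sum_y (\sum_x u x y) ^+ 2)
  - a * b * (\sum_x \sum_y u x y ^+ 2) <= tensor_form A A u.
Proof.
move=> p0 a0 b0 symA loA upA.
pose J (x y : T) : R := 1; pose X x y := A x y - p.
have qJ f : qform J f = (\sum_x f x) ^+ 2.
  rewrite expr2 big_distrl; apply: eq_bigr => x _ /=.
  by rewrite big_distrr; apply: eq_bigr => y _; rewrite /= mulr1.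
have qX f : qform X f = qform A f - p * (\sum_x f x) ^+ 2.
  rewrite -qJ /qform big_distrr -sumrB; apply: eq_bigr => x _ /=.
  rewrite big_distrr -sumrB; apply: eq_bigr => y _ /=; rewrite /X /J; ring.
have loX f : - a * \sum_x f x ^+ 2 <= qform X f.
  by rewrite qX; have := loA f; lra.
have upX f : qform X f <= b * \sum_x f x ^+ 2.
  by rewrite qX; have := upA f; lra.
have := tensor_form_ge u a0 b0 (fun x y => congr1 (fun z => z - p) (symA x y)) loX upX.
rewrite -/X.
have -> : tensor_form A A u =
   tensor_form (fun x y => 1 * X x y + p * J x y) (fun x y => 1 * X x y + p * J x y) u.
  by apply: eq_tensor_form => x y; rewrite /X /J; ring.
rewrite !(tensor_formDl, tensor_formDr).
have rank1J Z : tensor_form J Z u = qform Z (fun y => \sum_x u x y).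
  rewrite -[LHS](_ : tensor_form (fun x x' => 1 * 1) Z u = _); last first.
    by apply: eq_tensor_form => // x y; rewrite /J mulr1.
  rewrite tensor_form_rank1; apply: eq_bigr => x _; apply: eq_bigr => y _.
  by under eq_bigr => z _ do rewrite mul1r;
     under [in X in _ * X]eq_bigr => z _ do rewrite mul1r.
have -> : tensor_form X J u = qform X (fun x => \sum_y u x y).
  apply: eq_bigr => x _; apply: eq_bigr => x' _.
  rewrite -mulrA big_distrl; apply: eq_bigr => y _ /=.
  by rewrite mulrA big_distrr; apply: eq_bigr => y' _ /=; rewrite /J; ring.
rewrite !rank1J qJ.
rewrite [\sum_y \sum_x u x y]exchange_big.
have := loX (fun y => \sum_x u x y); have := loX (fun x => \sum_y u x y).
set s1 := \sum_x (_ ^+ 2); set s2 := \sum_x (_ ^+ 2).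
set x1 := qform _ _; set x2 := qform _ _; set c := \sum_x _; set d := \sum_x _.
move=> h1 h2 h3.
have g1 := ler_wpM2l p0 h1; have g2 := ler_wpM2l p0 h2.
lra.
Qed.

End QuadraticForms.

(** * A dense triangle-free graph with asymmetric spectrum *)

Section AnisotropicForm.
Local Open Scope ring_scope.
Variables (F : finFieldType) (d : F).
Hypothesis two0 : (2 : F) = 0.
Hypothesis d_irr : forall x : F, x ^+ 2 + x != d.
Variable R : realFieldType.
Let q : R := #|F|%:R.

Lemma oppF (x : F) : - x = x.
Proof. by apply/eqP; rewrite -subr_eq0 -opprD oppr_eq0 -mulr2n -mulr_natl two0 mul0r. Qed.

Lemma subF (x y : F) : x - y = y - x.
Proof. by rewrite -[LHS]oppF opprB. Qed.

(** In characteristic 2, the norm form of the quadratic extension generated by a root of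
    [x ^+ 2 + x = d]. *)
Definition anorm (u v : F) : F := u ^+ 2 + u * v + d * v ^+ 2.

Lemma anorm_eq0 u v : (anorm u v == 0) = (u == 0) && (v == 0).
Proof.
apply/eqP/andP=> [|[/eqP-> /eqP->]]; last by rewrite /anorm; ring.
have [-> | v0 Q0] := eqVneq v 0.
  rewrite /anorm mulr0 expr0n /= mulr0 !addr0 => /eqP.
  by rewrite expf_eq0 /= => /eqP ->.
case/negP: (d_irr (u / v)); rewrite -subr_eq0.
have -> : (u / v) ^+ 2 + u / v - d = anorm u v / v ^+ 2 - 2 * d.
  by rewrite /anorm; field.
by rewrite Q0 two0 !mul0r subrr.
Qed.

Lemma card_F_gt1 : 1 < q.
Proof.
rewrite ltr1n (cardD1 (0 : F)) inE (cardD1 (1 : F)) !inE oner_neq0 //.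
Qed.

Lemma sqr_inj : injective (fun x : F => x ^+ 2).
Proof.
move=> x y /= /eqP; rewrite -subr_eq0 subr_sqr -[x + y]/(x + y) -{2}(oppF y) -expr2.
by rewrite expf_eq0 /= subr_eq0 => /eqP.
Qed.

Let r (c : F) : R := \sum_u \sum_v (anorm u v == c)%:R.

Lemma sum_eq_natr (T : finType) (x : T) : \sum_y (y == x)%:R = 1 :> R.
Proof.
by rewrite -[RHS](sum_indicator x (fun=> 1 : R)); under eq_bigr do rewrite -[_%:R]mulr1.
Qed.

Lemma sum_const_F (x : R) : \sum_(c : F) x = q * x.
Proof. by rewrite sumr_const -mulr_natl. Qed.

Lemma count_anorm0 : r 0 = 1.
Proof.
rewrite /r -[RHS](sum_eq_natr (0 : F)); apply: eq_bigr => u _.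
under eq_bigr => v _ do rewrite anorm_eq0 -mulnb natrM mulrC.
by rewrite sum_indicator.
Qed.

(* Squaring is bijective in characteristic 2, so every line through the origin meets each nonzero level set of [anorm] exactly once. *)
Lemma count_anorm (c : F) : c != 0 -> r c = q + 1.
Proof.
move=> c0.
have rZ l b : l != 0 -> r (l ^+ 2 * b) = r b.
  move=> l0; rewrite /r.
  rewrite (reindex_inj (mulfI l0)); apply: eq_bigr => u _ /=.
  rewrite (reindex_inj (mulfI l0)); apply: eq_bigr => v _ /=.
  congr (_ %:R); rewrite (_ : anorm (l * u) (l * v) = l ^+ 2 * anorm u v); last first.
    by rewrite /anorm; ring.
  by rewrite (inj_eq (mulfI _)) // expf_neq0.
have rE b : b != 0 -> r b = r c.
  move=> b0; have /codomP[l Dl] : b / c \in codom (fun x : F => x ^+ 2).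
    exact: (inj_card_onto sqr_inj).
  have l0 : l != 0.
    apply: contra_neq b0 => l0; move: Dl; rewrite l0 expr0n /= => /eqP.
    by rewrite mulf_eq0 invr_eq0 (negPf c0) orbF => /eqP.
  by rewrite -(rZ l c) // -Dl divfK.
have total : \sum_b r b = q * q.
  rewrite /r exchange_big /= -sum_const_F; apply: eq_bigr => u _.
  rewrite exchange_big /= -[RHS]mulr1 -sum_const_F; apply: eq_bigr => v _.
  by under eq_bigr => b _ do rewrite eq_sym; rewrite sum_eq_natr.
move: total; rewrite (bigD1 0) //= count_anorm0.
rewrite (eq_bigr (fun=> r c)) => [|b]; last exact: rE.
have -> : \sum_(b : F | b != 0) r c = (q - 1) * r c.
  rewrite mulrBl mul1r -sum_const_F [in RHS](bigD1 (0 : F)) //=; ring.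
have := card_F_gt1 => q1 h; apply: (mulfI (x := q - 1)).
  by rewrite subr_eq0 gt_eqF.
by rewrite -[LHS](addKr 1) h; ring.
Qed.

Lemma count_linear (a b c : F) : (a != 0) || (b != 0) ->
  \sum_u \sum_v (a * u + b * v == c)%:R = q :> R.
Proof.
move=> ab0.
have solve (x y e : F) : x != 0 -> \sum_u (x * u + y == e)%:R = 1 :> R.
  move=> x0; rewrite -[RHS](sum_eq_natr ((e - y) / x)); apply: eq_bigr => u _.
  congr (_%:R); rewrite -subr_eq0 -[in RHS]subr_eq0.
  rewrite (_ : u - (e - y) / x = (x * u + y - e) / x); last by field.
  by rewrite mulf_eq0 invr_eq0 (negPf x0) orbF.
have [b0|b0] := boolP (b != 0).
  under eq_bigr => u _.
    under eq_bigr => v _ do rewrite addrC.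
    rewrite solve //; over.
  by rewrite sum_const_F mulr1.
rewrite (negPf b0) orbF in ab0; rewrite exchange_big /=.
under eq_bigr => v _ do rewrite solve //.
by rewrite sum_const_F mulr1.
Qed.

(* A vertex [(c, (u, v, e))] is a point of [F^4]; two of them with [c <> c'] are collinear when their difference is isotropic for the elliptic form [anorm u v - c e]. *)
Notation P := (F * F * F)%type.
Notation px y := (y.1.1).
Notation py y := (y.1.2).
Notation pe y := (y.2).

Definition cone (c : F) (y y' : P) : bool :=
  (pe y - pe y') * c == anorm (px y - px y') (py y - py y').

Lemma sum_point (h : P -> R) : \sum_y h y = \sum_u \sum_v \sum_e h (u, v, e).
Proof.
by rewrite !pair_bigA; apply: eq_bigr => -[[u v] e].
Qed.

Lemma sum_cone_last (c a b : F) : c != 0 -> \sum_e ((e - a) * c == b)%:R = 1 :> R.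
Proof.
move=> c0; rewrite -[RHS](sum_eq_natr (b / c + a)); apply: eq_bigr => e _.
congr (_%:R); rewrite -subr_eq0 -[in RHS]subr_eq0.
rewrite (_ : e - (b / c + a) = ((e - a) * c - b) / c); last by field.
by rewrite mulf_eq0 invr_eq0 (negPf c0) orbF.
Qed.

Lemma cone0E (y y' : P) : cone 0 y y' = (y.1 == y'.1).
Proof.
rewrite /cone mulr0 eq_sym anorm_eq0 !subr_eq0.
by case: y y' => [[u v] e] [[u' v'] e'].
Qed.

Lemma coneC (c : F) (y y' : P) : cone c y y' = cone c y' y.
Proof.
by rewrite /cone (subF (pe y)) (subF (px y)) (subF (py y)).
Qed.

Lemma sum_cone (c : F) (y : P) : c != 0 -> \sum_x (cone c x y)%:R = q * q :> R.
Proof.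
move=> c0; rewrite sum_point -sum_const_F; apply: eq_bigr => u _.
rewrite -[RHS]mulr1 -sum_const_F; apply: eq_bigr => v _.
by rewrite /cone /= sum_cone_last.
Qed.

Lemma sum_cone0 (y : P) : \sum_x (cone 0 x y)%:R = q :> R.
Proof.
rewrite sum_point; under eq_bigr => u _.
  under eq_bigr => v _.
    under eq_bigr => e _.
      rewrite cone0E /= (_ : ((u, v) == y.1) = (v == py y) && (u == px y)); last first.
        by rewrite andbC; case: (y) => [[]].
      rewrite -mulnb natrM; over.
    rewrite sum_const_F mulrCA; over.
  rewrite sum_indicator mulrC; over.
by rewrite sum_indicator.
Qed.

(** The first cone determines the last coordinate. Substituting into the second and completing the
    square leaves a level set of [anorm], with [q + 1] points, or one point at level 0; the level is
    0 exactly when [y] and [y'] lie on a common cone for [c' - c]. *)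
Lemma sum_cone_cone (c c' : F) (y y' : P) : c != 0 -> c' != 0 -> c != c' ->
  \sum_x (cone c x y)%:R * (cone c' x y')%:R = q + 1 - q * (cone (c' - c) y y')%:R :> R.
Proof.
move=> c0 c'0 cc'; pose k := c' - c.
have k0 : k != 0 by rewrite subr_eq0 eq_sym.
rewrite sum_point.
pose s := px y - px y'; pose t := py y - py y'; pose e0 := pe y' - pe y.
have inner u v : \sum_e (cone c (u, v, e) y)%:R * (cone c' (u, v, e) y')%:R =
  (anorm (k * (u - px y) - c * s) (k * (v - py y) - c * t)
    == c * c' * (anorm s t + k * e0))%:R :> R.
  rewrite /cone /=.
  set n := anorm (u - px y) _; set n' := anorm (u - px y') _.
  under eq_bigr => e _.
    rewrite (_ : ((e - pe y) * c == n) = (e == n / c + pe y)); last first.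
      rewrite -subr_eq0 -[in RHS]subr_eq0.
      rewrite (_ : e - (n / c + pe y) = ((e - pe y) * c - n) / c); last by field.
      by rewrite mulf_eq0 invr_eq0 (negPf c0) orbF.
    over.
  rewrite sum_indicator; congr (_%:R); rewrite -subr_eq0 -[in RHS]subr_eq0.
  rewrite (_ : anorm (k * _ - _) _ - _ =
     k * c * ((n / c + pe y - pe y') * c' - n')); last first.
    by rewrite /n /n' /anorm /s /t /e0 /k; field.
  by rewrite !mulf_eq0 (negPf k0) (negPf c0).
under eq_bigr => u _ do (under eq_bigr => v _ do rewrite inner).
set b := c * c' * _.
have -> : \sum_u \sum_v (anorm (k * (u - px y) - c * s) (k * (v - py y) - c * t) == b)%:R = r b.
  rewrite [in RHS]/r.
  have inj z : injective (fun u : F => k * (u - z) - c * s).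
    by move=> ? ? /= /addIr/(mulfI k0)/addIr.
  have inj' z : injective (fun u : F => k * (u - z) - c * t).
    by move=> ? ? /= /addIr/(mulfI k0)/addIr.
  rewrite [RHS](reindex_inj (inj (px y))); apply: eq_bigr => u _ /=.
  by rewrite [RHS](reindex_inj (inj' (py y))).
rewrite /cone -/s -/t -/k.
rewrite (_ : ((pe y - pe y') * k == anorm s t) = (b == 0)); last first.
  rewrite /b !mulf_eq0 (negPf c0) (negPf c'0) /= -subr_eq0 -oppr_eq0; congr (_ == _).
  by rewrite /e0; ring.
have [-> | b0] := eqVneq b 0; first by (rewrite count_anorm0 mulr1; ring).
by rewrite count_anorm // mulr0 subr0.
Qed.

(** For equal parameters the quadratic parts cancel, and the equation left in [u] and [v] is a line
    with [q] points unless [y] and [y'] agree in their first two coordinates. *)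
Lemma sum_cone_cone_diag (c : F) (y y' : P) : c != 0 ->
  \sum_x (cone c x y)%:R * (cone c x y')%:R =
  q * q * (y == y')%:R + q - q * (cone 0 y y')%:R :> R.
Proof.
move=> c0; rewrite sum_point.
pose s := px y - px y'; pose t := py y - py y'; pose e0 := pe y' - pe y.
have inner u v : \sum_e (cone c (u, v, e) y)%:R * (cone c (u, v, e) y')%:R =
  (t * u + s * v == t * px y + s * py y - anorm s t - e0 * c)%:R :> R.
  rewrite /cone /=.
  set n := anorm (u - px y) _; set n' := anorm (u - px y') _.
  under eq_bigr => e _.
    rewrite (_ : ((e - pe y) * c == n) = (e == n / c + pe y)); last first.
      rewrite -subr_eq0 -[in RHS]subr_eq0.
      rewrite (_ : e - (n / c + pe y) = ((e - pe y) * c - n) / c); last by field.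
      by rewrite mulf_eq0 invr_eq0 (negPf c0) orbF.
    over.
  rewrite sum_indicator; congr (_%:R); rewrite -subr_eq0 -[in RHS]subr_eq0 -oppr_eq0.
  congr (_ == _); rewrite -[RHS]addr0.
  (* The two sides differ by this multiple of 2, which vanishes in characteristic 2. *)
  rewrite -(mul0r (s * (u - px y) + d * t * (v - py y))) -two0.
  by rewrite /n /n' /anorm /s /t /e0; field.
under eq_bigr => u _ do (under eq_bigr => v _ do rewrite inner).
have yy' : (y == y') = [&& s == 0, t == 0 & e0 == 0].
  rewrite /s /t /e0 !subr_eq0 (eq_sym (pe y')).
  by case: (y) (y') => [[? ?] ?] [[? ?] ?]; rewrite !xpair_eqE andbA.
have K0 : cone 0 y y' = (s == 0) && (t == 0).
  by rewrite cone0E /s /t !subr_eq0; case: (y) (y') => [[? ?] ?] [[? ?] ?].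
rewrite yy' K0; have [s0|s0] := eqVneq s 0; last first.
  by rewrite count_linear ?s0 ?orbT //= !mulr0 add0r subr0.
have [t0|t0] := eqVneq t 0; last first.
  by rewrite count_linear ?t0 //= !mulr0 add0r subr0.
rewrite s0 t0 /= mulr1 addrK.
rewrite (eq_bigr (fun=> q * (e0 == 0)%:R)); first by rewrite sum_const_F mulrA.
move=> u _; rewrite -sum_const_F; apply: eq_bigr => v _; congr (_%:R).
have -> : anorm 0 0 = 0 by rewrite /anorm; ring.
by rewrite !mul0r !addr0 subr0 sub0r eq_sym oppr_eq0 mulf_eq0 (negPf c0) orbF.
Qed.

Lemma sum_cone0_cone (c : F) (y y' : P) : c != 0 ->
  \sum_x (cone 0 x y)%:R * (cone c x y')%:R = 1 :> R.
Proof.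
move=> c0; rewrite sum_point.
under eq_bigr => u _.
  under eq_bigr => v _.
    under eq_bigr => e _.
      rewrite cone0E /= (_ : ((u, v) == y.1) = (v == py y) && (u == px y)); last first.
        by rewrite andbC; case: (y) => [[]].
      rewrite -mulnb natrM -mulrA; over.
    rewrite -big_distrr -big_distrr /=; over.
  rewrite sum_indicator; over.
by rewrite sum_indicator /cone /= sum_cone_last.
Qed.

Lemma sum_cone0_cone0 (y y' : P) :
  \sum_x (cone 0 x y)%:R * (cone 0 x y')%:R = q * (cone 0 y y')%:R :> R.
Proof.
rewrite mulrC -(sum_cone0 y) big_distrr; apply: eq_bigr => x _ /=.
rewrite !cone0E; have [-> | _] := eqVneq x.1 y.1; rewrite ?mul0r ?mulr0 //.
by rewrite mul1r mulr1.
Qed.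



Let q1 : 1 < q := card_F_gt1.
Let q0 : 0 < q := lt_trans ltr01 q1.
Let qn0 : q != 0 := lt0r_neq0 q0.

(** At [c = 0] this is the orthogonal projection onto the functions with zero mean along the last
    coordinate; the other kernels are [cone c] rescaled and centred. *)
Definition weil_kernel (c : F) (x y : P) : R :=
  (if c == 0 then (x == y)%:R else (q ^+ 2)^-1) - (cone c x y)%:R / q.

(* Up to a scalar and a constant, [c |-> cone c] is a unitary representation of the additive group of [F]. *)
Lemma weil_kernel_comp (c c' : F) (y y' : P) :
  \sum_x weil_kernel c x y * weil_kernel c' x y' = weil_kernel (c' - c) y y'.
Proof.
have cardP (a : R) : \sum_(x : P) a = q ^+ 3 * a.
  by rewrite sumr_const !card_prod -mulr_natl !natrM; ring.
have expand (a b : P -> R) (k k' : P -> bool) :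
    \sum_x (a x - (k x)%:R / q) * (b x - (k' x)%:R / q) =
    \sum_x a x * b x - (\sum_x (k x)%:R * b x) / q - (\sum_x a x * (k' x)%:R) / q
      + (\sum_x (k x)%:R * (k' x)%:R) / q ^+ 2.
  rewrite !big_distrl -sumrB -sumrB -big_split; apply: eq_bigr => x _ /=.
  by field.
rewrite /weil_kernel; have [->|c0] := eqVneq c 0; have [->|c'0] := eqVneq c' 0.
- rewrite subrr eqxx expand.
  rewrite (sum_indicator y (fun x => (x == y')%:R)).
  rewrite (sum_indicator y (fun x => (cone 0 x y')%:R)) sum_cone0_cone0.
  under [X in _ - X / q - _]eq_bigr => x _ do rewrite mulrC.
  rewrite (sum_indicator y' (fun x => (cone 0 x y)%:R)) (coneC 0 y').
  by field.
- rewrite subr0 (negPf c'0) expand -!big_distrl /= sum_cone0_cone // sum_cone0.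
  rewrite (sum_indicator y (fun x => (cone c' x y')%:R)) sum_eq_natr.
  by field.
- rewrite sub0r oppF (negPf c0) expand -!big_distrr /= sum_cone0.
  under [X in _ - X / q - _]eq_bigr => x _ do rewrite mulrC.
  under [X in _ + X / _]eq_bigr => x _ do rewrite mulrC.
  rewrite (sum_indicator y' (fun x => (cone c x y)%:R)) sum_eq_natr sum_cone0_cone //.
  by rewrite (coneC c y'); field.
rewrite expand -!big_distrl -!big_distrr /= cardP !sum_cone // subr_eq0 (eq_sym c').
have [<-|cc'] := eqVneq c c'; last by rewrite sum_cone_cone //; field.
by rewrite subrr sum_cone_cone_diag //; field.
Qed.

(** * Quadratic forms of Gram kernels and of partitions *)

Lemma qform_gram (T T' : finType) (M : T' -> T -> R) (g : T -> R) :
  qform (fun i j => \sum_x M x i * M x j) g = \sum_x (\sum_i M x i * g i) ^+ 2.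
Proof.
rewrite /qform [RHS](eq_bigr (fun x => \sum_i \sum_j g i * (M x i * M x j) * g j)).
  rewrite [RHS]exchange_big; apply: eq_bigr => i _ /=.
  rewrite exchange_big; apply: eq_bigr => j _ /=.
  by rewrite big_distrr big_distrl.
move=> x _; rewrite expr2 big_distrl; apply: eq_bigr => i _ /=.
by rewrite big_distrr; apply: eq_bigr => j _ /=; ring.
Qed.

Lemma qform_fiber (T T' : finType) (h : T -> T') (g : T -> R) :
  qform (fun i j => (h i == h j)%:R) g =
  \sum_b (\sum_i (h i == b)%:R * g i) ^+ 2.
Proof.
rewrite -qform_gram; apply: eq_bigr => i _; apply: eq_bigr => j _.
congr (_ * _ * _); rewrite -(sum_indicator (h i) (fun b => (b == h j)%:R)).
by apply: eq_bigr => b _; rewrite eq_sym (eq_sym b).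
Qed.

Lemma qform_fiber_ge0 (T T' : finType) (h : T -> T') (g : T -> R) :
  0 <= qform (fun i j => (h i == h j)%:R) g.
Proof. by rewrite qform_fiber sumr_ge0 // => b _; rewrite sqr_ge0. Qed.

(** Weighted Cauchy-Schwarz, from the nonnegative sum of [p x * (n * g x - s) ^+ 2]. *)
Lemma sqr_sum_le (T : finType) (p g : T -> R) : (forall x, 0 <= p x) ->
  (\sum_x p x * g x) ^+ 2 <= (\sum_x p x) * \sum_x p x * g x ^+ 2.
Proof.
move=> p0; set n := \sum_x p x; set s := \sum_x _; set t := \sum_x _.
have n0 : 0 <= n by apply: sumr_ge0.
have [nz|nz] := eqVneq n 0.
  have pz x : p x = 0.
    apply/eqP; rewrite eq_le p0 andbT -nz /n (bigD1 x) //= lerDl.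
    exact: sumr_ge0.
  rewrite nz mul0r /s big1 ?expr0n //= => x _; by rewrite pz mul0r.
have h : 0 <= n * (n * t - s ^+ 2).
  have -> : n * (n * t - s ^+ 2) = \sum_x p x * (n * g x - s) ^+ 2.
    rewrite [RHS](eq_bigr (fun x => n ^+ 2 * (p x * g x ^+ 2) - 2 * n * s * (p x * g x)
      + s ^+ 2 * p x)) => [|x _]; last by ring.
    by rewrite big_split sumrB -!big_distrr /= -/s -/t -/n; ring.
  by apply: sumr_ge0 => x _; rewrite mulr_ge0 ?p0 ?sqr_ge0.
by move: h; rewrite pmulr_rge0 ?subr_ge0 // lt_def nz.
Qed.

Lemma qform_fiber_le (T T' : finType) (h : T -> T') (n : R) (g : T -> R) :
  (forall b, \sum_i (h i == b)%:R = n) ->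
  qform (fun i j => (h i == h j)%:R) g <= n * \sum_i g i ^+ 2.
Proof.
move=> fibn; rewrite qform_fiber.
apply: (@le_trans _ _ (\sum_b n * \sum_i (h i == b)%:R * g i ^+ 2)).
  apply: ler_sum => b _; rewrite -(fibn b); apply: sqr_sum_le => x.
  exact: ler0n.
rewrite -big_distrr exchange_big /= le_eqVlt; apply/orP; left; apply/eqP.
congr (_ * _); apply: eq_bigr => i _.
by under eq_bigr => b _ do rewrite eq_sym; rewrite sum_indicator.
Qed.

Lemma qform_fiber_ge (T T' : finType) (h : T -> T') (g : T -> R) :
  (\sum_i g i) ^+ 2 <= #|T'|%:R * qform (fun i j => (h i == h j)%:R) g.
Proof.
rewrite qform_fiber.
have -> : \sum_i g i = \sum_b 1 * \sum_i (h i == b)%:R * g i.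
  under [RHS]eq_bigr => b _ do rewrite mul1r.
  rewrite exchange_big; apply: eq_bigr => i _ /=.
  by under eq_bigr => b _ do rewrite eq_sym; rewrite sum_indicator.
apply: le_trans (sqr_sum_le _ _) _ => [_|]; first exact: ler01.
rewrite sumr_const; under eq_bigr do rewrite mul1r.
by [].
Qed.

(** * The collinearity graph and its spectral bounds *)

Notation V := (F * P)%type.

Definition collinear (i j : V) : bool := (i.1 != j.1) && cone (j.1 - i.1) i.2 j.2.

(** The point where the line through [i] in the isotropic direction [(1, w, anorm w)] meets the
    hyperplane of first coordinate 0. It names the line within its parallel class. *)
Definition line_base (w : F * F) (i : V) : P :=
  (px i.2 - i.1 * w.1, py i.2 - i.1 * w.2, pe i.2 - i.1 * anorm w.1 w.2).

Definition direction (i j : V) : F * F :=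
  ((px i.2 - px j.2) / (i.1 - j.1), (py i.2 - py j.2) / (i.1 - j.1)).

Lemma line_baseE w (i j : V) : i.1 != j.1 ->
  (line_base w i == line_base w j) = (w == direction i j) && collinear i j.
Proof.
case: i j w => [c [[u v] e]] [c' [[u' v'] e']] [w1 w2] /= cc'.
have cc0 : c - c' != 0 by rewrite subr_eq0.
rewrite /line_base /collinear /direction /cone /= !xpair_eqE cc' /=.
have dir (x x' z : F) : (x - c * z == x' - c' * z) = (z == (x - x') / (c - c')).
  rewrite -subr_eq0 -[in RHS]subr_eq0.
  rewrite (_ : z - _ = - (x - c * z - (x' - c' * z)) / (c - c')); last by field.
  by rewrite mulf_eq0 invr_eq0 (negPf cc0) orbF oppr_eq0.
rewrite !dir; case: eqP => //= Dw1; case: eqP => //= Dw2.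
rewrite (subF c') Dw1 Dw2 -subr_eq0 -[in RHS]subr_eq0.
rewrite (_ : (e - e') * (c - c') - anorm _ _ = - (c - c') ^+ 2 *
   (anorm ((u - u') / (c - c')) ((v - v') / (c - c')) - (e - e') / (c - c'))); last first.
  by rewrite /anorm; field.
by rewrite mulf_eq0 oppr_eq0 expf_eq0 /= (negPf cc0).
Qed.

Lemma line_base_inj w (i j : V) : i.1 = j.1 ->
  (line_base w i == line_base w j) = (i == j).
Proof.
case: i j w => [c [[u v] e]] [c' [[u' v'] e']] [w1 w2] /= <-.
by rewrite /line_base !xpair_eqE /= !(inj_eq (addIr _)) eqxx.
Qed.

(** Each [w] partitions the points into parallel lines, and two distinct points share a line for at
    most one [w]; the subtracted diagonal removes the pairs [i = j]. *)
Lemma collinear_lines (i j : V) :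
  (collinear i j)%:R =
  \sum_w ((line_base w i == line_base w j)%:R - (i == j)%:R) :> R.
Proof.
have [ij|ij] := eqVneq i.1 j.1.
  by rewrite /collinear ij eqxx big1 // => w _; rewrite line_base_inj // subrr.
have -> : (i == j) = false by apply: contraNF ij => /eqP ->.
under eq_bigr => w _ do rewrite subr0 line_baseE // -mulnb natrM.
by rewrite sum_indicator.
Qed.

Lemma line_base_fiber w b : \sum_i (line_base w i == b)%:R = q.
Proof.
rewrite -[RHS]mulr1 -sum_const_F.
rewrite -(pair_bigA _ (fun c y => (line_base w (c, y) == b)%:R)) /=.
apply: eq_bigr => c _.
rewrite -[RHS](sum_eq_natr (px b + c * w.1, py b + c * w.2, pe b + c * anorm w.1 w.2)).
apply: eq_bigr => -[[u v] e] _; congr (_%:R).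
by case: b => [[b1 b2] b3]; rewrite /line_base !xpair_eqE /= !subr_eq.
Qed.

Lemma qformD (T : finType) (Y Z : T -> T -> R) f :
  qform (fun x y => Y x y + Z x y) f = qform Y f + qform Z f.
Proof.
rewrite -big_split; apply: eq_bigr => x _; rewrite -big_split.
by apply: eq_bigr => y _ /=; rewrite mulrDr mulrDl.
Qed.

Lemma qformZ (T : finType) (a : R) (Z : T -> T -> R) f :
  qform (fun x y => a * Z x y) f = a * qform Z f.
Proof.
rewrite /qform big_distrr; apply: eq_bigr => x _; rewrite /= big_distrr.
by apply: eq_bigr => y _ /=; ring.
Qed.

Lemma qform_sum (T I : finType) (Z : I -> T -> T -> R) f :
  qform (fun x y => \sum_i Z i x y) f = \sum_i qform (Z i) f.
Proof.
rewrite /qform [RHS]exchange_big; apply: eq_bigr => x _ /=.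
rewrite [RHS]exchange_big; apply: eq_bigr => y _ /=.
by rewrite big_distrr big_distrl.
Qed.

Lemma eq_qform (T : finType) (Y Z : T -> T -> R) f :
  Y =2 Z -> qform Y f = qform Z f.
Proof. by move=> e; do 2![apply: eq_bigr => ? _]; rewrite e. Qed.

Lemma qform_id (T : finType) (f : T -> R) :
  qform (fun x y => (x == y)%:R) f = \sum_x f x ^+ 2.
Proof.
apply: eq_bigr => x _; under eq_bigr => y _ do rewrite eq_sym mulrAC mulrC.
by rewrite sum_indicator.
Qed.

Lemma qform_one (T : finType) (f : T -> R) :
  qform (fun x y => 1) f = (\sum_x f x) ^+ 2.
Proof.
rewrite expr2 big_distrl; apply: eq_bigr => x _ /=; rewrite big_distrr.
by apply: eq_bigr => y _; rewrite mulr1.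
Qed.

(** By [weil_kernel_comp], the kernels [weil_kernel (c' - c)] form a Gram matrix. Collinearity is
    [q] times the identity plus [q^-1] times the all-ones kernel, minus positive semidefinite
    kernels, which are dropped. *)
Lemma qform_collinear_le (g : V -> R) :
  qform (fun i j => (collinear i j)%:R) g <=
  q^-1 * (\sum_i g i) ^+ 2 + q * \sum_i g i ^+ 2.
Proof.
pose M x (i : V) := weil_kernel i.1 x i.2.
have W0 : 0 <= qform (fun i j => \sum_x M x i * M x j) g.
  by rewrite qform_gram sumr_ge0 // => x _; rewrite sqr_ge0.
have Z0 := qform_fiber_ge0 (fun i : V => (i.1, i.2.1)) g.
have C0 := qform_fiber_ge0 (fun i : V => i.1) g.
rewrite (eq_qform (Z := fun i j => (q * (i == j)%:R + -1 *
    ((i.1, i.2.1) == (j.1, j.2.1))%:R) + (q^-1 * 1 + - q^-1 * (i.1 == j.1)%:R)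
    + - q * \sum_x M x i * M x j)); last first.
  move=> i j; rewrite weil_kernel_comp /collinear xpair_eqE /weil_kernel.
  case: i j => [c y] [c' y'] /=; rewrite xpair_eqE.
  rewrite subr_eq0 (eq_sym c'); have [<-|cc'] := eqVneq c c' => /=.
    by rewrite subrr cone0E; field.
  by field.
rewrite !qformD !qformZ qform_id qform_one -subr_ge0.
have := mulr_ge0 (ltW q0) W0.
have : 0 <= q^-1 * qform (fun i j : V => (i.1 == j.1)%:R) g.
  by rewrite mulr_ge0 // invr_ge0 ltW.
lra.
Qed.

(** Each of the [q ^ 2] parallel classes consists of [q ^ 3] lines; Cauchy-Schwarz over these lines
    bounds its form from below. *)
Lemma qform_collinear_ge (g : V -> R) :
  q^-1 * (\sum_i g i) ^+ 2 - q ^+ 2 * \sum_i g i ^+ 2 <=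
  qform (fun i j => (collinear i j)%:R) g.
Proof.
rewrite (eq_qform _ collinear_lines) qform_sum.
have cW (a : R) : \sum_(w : F * F) a = q ^+ 2 * a.
  by rewrite sumr_const card_prod -mulr_natl natrM; ring.
rewrite (_ : q^-1 * _ - _ = \sum_(w : F * F) ((q ^+ 3)^-1 * (\sum_i g i) ^+ 2
    - \sum_i g i ^+ 2)); last by rewrite cW; field.
apply: ler_sum => w _.
have -> : qform (fun i j => (line_base w i == line_base w j)%:R - (i == j)%:R) g =
   qform (fun i j => (line_base w i == line_base w j)%:R) g - \sum_i g i ^+ 2.
  rewrite -qform_id -mulN1r -qformZ -qformD; apply: eq_qform => i j.
  by rewrite mulN1r.
rewrite lerD2r mulrC ler_pdivrMr ?exprn_gt0 // mulrC.
apply: le_trans (qform_fiber_ge (line_base w) g) _.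
by rewrite !card_prod !natrM le_eqVlt; apply/orP; left; apply/eqP; ring.
Qed.

Lemma qform_line (w : F * F) (g : V -> R) :
  - \sum_i g i ^+ 2 <=
  qform (fun i j => (line_base w i == line_base w j)%:R - (i == j)%:R) g
  <= (q - 1) * \sum_i g i ^+ 2.
Proof.
have -> : qform (fun i j => (line_base w i == line_base w j)%:R - (i == j)%:R) g =
   qform (fun i j => (line_base w i == line_base w j)%:R) g - \sum_i g i ^+ 2.
  rewrite -qform_id -mulN1r -qformZ -qformD; apply: eq_qform => i j.
  by rewrite mulN1r.
have := qform_fiber_ge0 (line_base w) g.
have := qform_fiber_le g (line_base_fiber w).
by move=> h1 h2; apply/andP; split; lra.
Qed.

Lemma bessel (S I : finType) (x : I -> S -> R) (f : S -> R) :
  (forall i j, \sum_s x i s * x j s = (i == j)%:R * #|S|%:R) ->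
  \sum_i (\sum_s x i s * f s) ^+ 2 <= #|S|%:R * \sum_s f s ^+ 2.
Proof.
move=> orth; set N : R := #|S|%:R; pose a i := \sum_s x i s * f s.
have [N0|Nn0] := eqVneq N 0.
  have noS (s : S) : False.
    by move/eqP: N0; rewrite pnatr_eq0 => /pred0P/(_ s).
  rewrite N0 mul0r big1 // => i _; rewrite big1 ?expr0n // => s; by case: (noS s).
have h : 0 <= \sum_s (N * f s - \sum_i a i * x i s) ^+ 2.
  by apply: sumr_ge0 => s _; apply: sqr_ge0.
have e : \sum_s (N * f s - \sum_i a i * x i s) ^+ 2 =
    N * (N * \sum_s f s ^+ 2 - \sum_i a i ^+ 2).
  have -> : \sum_s (N * f s - \sum_i a i * x i s) ^+ 2 =
    N ^+ 2 * \sum_s f s ^+ 2 - 2 * N * \sum_s f s * (\sum_i a i * x i s)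
    + \sum_s (\sum_i a i * x i s) ^+ 2.
    rewrite (eq_bigr (fun s => N ^+ 2 * f s ^+ 2 -
      2 * N * (f s * (\sum_i a i * x i s)) + (\sum_i a i * x i s) ^+ 2)) => [|s _].
      by rewrite big_split sumrB /= -!big_distrr.
    by ring.
  have -> : \sum_s f s * (\sum_i a i * x i s) = \sum_i a i ^+ 2.
    under eq_bigr => s _ do rewrite big_distrr /=.
    rewrite exchange_big; apply: eq_bigr => i _ /=.
    by rewrite expr2 {3}/a big_distrr; apply: eq_bigr => s _ /=; ring.
  rewrite [X in _ + X = _](eq_bigr (fun s => (\sum_i x i s * a i) ^+ 2)) => [|s _]; last first.
    by congr (_ ^+ 2); apply: eq_bigr => i _; rewrite mulrC.
  rewrite -(qform_gram (fun s i => x i s)).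
  rewrite (eq_qform (Z := fun i j => N * (i == j)%:R)) => [|i j]; last first.
    by rewrite orth mulrC.
  by rewrite qformZ qform_id; ring.
move: h; rewrite e pmulr_rge0 ?subr_ge0 //.
by rewrite lt_def Nn0 ler0n.
Qed.

(** * Random signs along the lines *)

Section Signs.
Variables (j : nat) (code : option (F * F) -> {ffun 'I_j -> bool}).
Hypothesis code_inj : injective code.
Hypothesis code_None : code None = [ffun => false].
Notation S := {ffun 'I_j -> bool}.
Let N : R := #|{: S}|%:R.

Definition parity (o : option (F * F)) (s : S) : bool :=
  \big[addb/false]_i (code o i && s i).

(** The character of the group of sign vectors given by [code o]; [None] supplies the trivial one,
    which carries the part of adjacency independent of the signs. *)
Definition sgn (o : option (F * F)) (s : S) : R := (-1) ^+ parity o s.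

Lemma sgn_None s : sgn None s = 1.
Proof.
by rewrite /sgn /parity big1 // => i _; rewrite code_None ffunE.
Qed.

Lemma sgn_orthogonal o o' :
  \sum_s sgn o s * sgn o' s = (o == o')%:R * N.
Proof.
have [<-|oo'] := eqVneq o o'.
  rewrite mul1r /N -sum1_card natr_sum; apply: eq_bigr => s _.
  by rewrite /sgn -signr_addb addbb.
rewrite mul0r.
have sgnE p s : sgn p s = \prod_i (-1) ^+ (code p i && s i).
  by rewrite /sgn /parity (big_morph _ (@signr_addb R) (erefl _)).
under eq_bigr => s _ do rewrite !sgnE -big_split /=.
(* The sum factors over the coordinates, and a coordinate where the codes differ contributes 1 - 1 =
   0. *)
rewrite -(bigA_distr_bigA (fun i b => (-1) ^+ (code o i && b) * (-1) ^+ (code o' i && b))).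
have [i Di] : exists i, code o i != code o' i.
  apply/existsP; apply: contra_neqT oo' => /existsPn same; apply: code_inj.
  by apply/ffunP => i; apply/eqP; rewrite -[_ == _]negbK same.
rewrite (bigD1 i) //= big_bool /= !andbT !andbF mulr1 -signr_addb.
by rewrite (_ : _ (+) _ = true) ?addNr ?mul0r //; case: (code o i) (code o' i) Di => -[].
Qed.

Notation T := (V * S)%type.

(* Each vertex carries a random sign for every direction, so that every line of the geometry becomes a random complete bipartite graph. *)
Definition adj (x y : T) : bool :=
  collinear x.1 y.1 &&
  (parity (Some (direction x.1 y.1)) x.2 != parity (Some (direction x.1 y.1)) y.2).

Lemma collinearC i i' : collinear i i' = collinear i' i.
Proof. by rewrite /collinear eq_sym (subF i'.1) coneC. Qed.

Lemma directionC i i' : direction i i' = direction i' i.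
Proof. by rewrite /direction (subF i.2.1.1) (subF i.1) (subF i.2.1.2). Qed.

Lemma adj_sym : symmetric adj.
Proof.
by move=> x y; rewrite /adj collinearC directionC eq_sym.
Qed.

Lemma adj_irr : irreflexive adj.
Proof. by move=> x; rewrite /adj eqxx andbF. Qed.

(* The geometry has no triangles: anisotropy of [anorm] forces three pairwise collinear points onto one line. *)
Lemma direction_eq i i' i'' :
  collinear i i' -> collinear i' i'' -> collinear i i'' ->
  direction i i' = direction i' i'' /\ direction i i'' = direction i' i''.
Proof.
case: i i' i'' => [c1 [[u1 v1] e1]] [c2 [[u2 v2] e2]] [c3 [[u3 v3] e3]].
rewrite /collinear /direction /cone /= => /andP[c12 /eqP E1] /andP[c23 /eqP E2] /andP[c13 /eqP E3].
have n12 : c1 - c2 != 0 by rewrite subr_eq0.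
have n23 : c2 - c3 != 0 by rewrite subr_eq0.
have n13 : c1 - c3 != 0 by rewrite subr_eq0.
have /eqP : anorm ((c2 - c3) * (u1 - u2) - (c1 - c2) * (u2 - u3))
     ((c2 - c3) * (v1 - v2) - (c1 - c2) * (v2 - v3)) = 0.
  transitivity ((c2 - c3) * (c1 - c3) * anorm (u1 - u2) (v1 - v2)
    + (c1 - c2) * (c1 - c3) * anorm (u2 - u3) (v2 - v3)
    - (c1 - c2) * (c2 - c3) * anorm (u1 - u3) (v1 - v3)); first by rewrite /anorm; ring.
  by rewrite -E1 -E2 -E3; ring.
rewrite anorm_eq0 !subr_eq0 => /andP[/eqP Eu /eqP Ev].
have Du : (u1 - u2) / (c1 - c2) = (u2 - u3) / (c2 - c3).
  by apply/eqP; rewrite eqr_div //; apply/eqP; rewrite mulrC Eu mulrC.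
have Dv : (v1 - v2) / (c1 - c2) = (v2 - v3) / (c2 - c3).
  by apply/eqP; rewrite eqr_div //; apply/eqP; rewrite mulrC Ev mulrC.
have add a b a' b' : a / b = a' / b' -> b != 0 -> b' != 0 -> b + b' != 0 ->
    (a + a') / (b + b') = a' / b' :> F.
  move=> E b0 b'0 bb'0; rewrite -[a](divfK b0) E; field.
  by rewrite b'0 bb'0.
split; first by rewrite Du Dv.
have -> : u1 - u3 = (u1 - u2) + (u2 - u3) by ring.
have -> : v1 - v3 = (v1 - v2) + (v2 - v3) by ring.
have Ec : c1 - c3 = (c1 - c2) + (c2 - c3) by ring.
by move: n13; rewrite Ec => n13'; rewrite (add _ _ _ _ Du) // (add _ _ _ _ Dv).
Qed.

(** The three vertices would lie on one line, and two of them would have the same parity in its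
    direction. *)
Lemma adj_triangle_free x y z : adj x y -> adj y z -> adj x z -> False.
Proof.
move=> /andP[cxy pxy] /andP[cyz pyz] /andP[cxz pxz].
have [D1 D2] := direction_eq cxy cyz cxz.
move: pxy pyz pxz; rewrite D1 D2.
by do 3![case: (parity _ _)].
Qed.

(** Two signs differ with indicator [(1 - s * s') / 2]. With the line expansion of collinearity,
    this writes adjacency as geometry times characters. *)
Lemma adj_sumE x y : (adj x y)%:R = 2^-1 *
  ((collinear x.1 y.1)%:R * (sgn None x.2 * sgn None y.2) - \sum_w
    ((line_base w x.1 == line_base w y.1)%:R - (x.1 == y.1)%:R) *
    (sgn (Some w) x.2 * sgn (Some w) y.2)).
Proof.
rewrite !sgn_None !mulr1 /adj.
have [xy|xy] := eqVneq x.1.1 y.1.1.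
  rewrite {1 2}/collinear xy eqxx /= big1 ?subrr ?mulr0 // => w _.
  by rewrite line_base_inj // subrr mul0r.
have -> : (x.1 == y.1) = false by apply: contraNF xy => /eqP ->.
rewrite (eq_bigr (fun w => (w == direction x.1 y.1)%:R *
   ((collinear x.1 y.1)%:R * (sgn (Some w) x.2 * sgn (Some w) y.2)))) => [|w _].
  rewrite sum_indicator /sgn -signr_addb -negb_eqb; case: (collinear _ _) => /=; last by ring.
  by case: eqP => _ /=; field.
by rewrite subr0 line_baseE // -mulnb natrM mulrA.
Qed.

(** An unnormalised Fourier coefficient of [f] in the sign variable; it reduces adjacency to forms
    on [V] alone. *)
Definition sgn_mean (f : T -> R) o (i : V) : R := \sum_s sgn o s * f (i, s).

Lemma sum_pair (I J : finType) (h : I * J -> R) :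
  \sum_x h x = \sum_i \sum_k h (i, k).
Proof. by rewrite pair_bigA; apply: eq_bigr => -[]. Qed.

Lemma qform_sgn (B : V -> V -> R) (f : T -> R) o :
  qform (fun x y => B x.1 y.1 * (sgn o x.2 * sgn o y.2)) f =
  qform B (sgn_mean f o).
Proof.
rewrite /qform sum_pair; apply: eq_bigr => i _.
under eq_bigr => s _ do rewrite sum_pair.
rewrite exchange_big; apply: eq_bigr => i' _ /=.
rewrite -mulrA big_distrl; apply: eq_bigr => s _ /=.
by rewrite !big_distrr; apply: eq_bigr => s' _ /=; ring.
Qed.

Lemma sum_option (I : finType) (h : option I -> R) :
  \sum_o h o = h None + \sum_i h (Some i).
Proof.
rewrite (bigD1 None) //=; congr (_ + _).
by rewrite (reindex_omap Some id) => [|[]] //; apply: eq_bigl => i; rewrite eqxx.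
Qed.

Lemma sgn_mean_le (f : T -> R) :
  \sum_i sgn_mean f None i ^+ 2 + \sum_w \sum_i sgn_mean f (Some w) i ^+ 2
    <= N * \sum_x f x ^+ 2.
Proof.
rewrite -(sum_option (fun o => \sum_i sgn_mean f o i ^+ 2)) exchange_big /=.
rewrite [\sum_x f x ^+ 2]sum_pair big_distrr /=.
by apply: ler_sum => i _; apply: (bessel _ sgn_orthogonal).
Qed.

Lemma sum_sgn_mean (f : T -> R) : \sum_i sgn_mean f None i = \sum_x f x.
Proof.
rewrite [RHS]sum_pair; apply: eq_bigr => i _.
by apply: eq_bigr => s _; rewrite sgn_None mul1r.
Qed.

Lemma qform_adjE (f : T -> R) : qform (fun x y => (adj x y)%:R) f = 2^-1 *
  (qform (fun i i' => (collinear i i')%:R) (sgn_mean f None) - \sum_w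
    qform (fun i i' => (line_base w i == line_base w i')%:R - (i == i')%:R)
      (sgn_mean f (Some w))).
Proof.
rewrite (eq_qform _ adj_sumE) qformZ; congr (_ * _).
under [in RHS]eq_bigr => w _ do rewrite -qform_sgn.
rewrite -qform_sgn -qform_sum -[in RHS]mulN1r -qformZ -qformD.
by apply: eq_qform => x y; rewrite mulN1r.
Qed.

(** Up to the factor 1/2, the trivial coefficient loses at most [q ^ 2] times its squared norm. The
    line terms enter with a minus sign and lose at most [q - 1 <= q ^ 2] times theirs. Bessel's
    inequality adds these up. *)
Lemma qform_adj_ge (f : T -> R) :
  (2 * q)^-1 * (\sum_x f x) ^+ 2 - (q ^+ 2 * N / 2) * \sum_x f x ^+ 2
  <= qform (fun x y => (adj x y)%:R) f.
Proof.
rewrite qform_adjE; set G0 := sgn_mean f None.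
have h1 := qform_collinear_ge G0; have h2 := sgn_mean_le f.
rewrite -/G0 in h2.
have h3 : \sum_w qform (fun i i' => (line_base w i == line_base w i')%:R - (i == i')%:R)
   (sgn_mean f (Some w)) <= q ^+ 2 * \sum_w \sum_i sgn_mean f (Some w) i ^+ 2.
  rewrite big_distrr; apply: ler_sum => w _ /=.
  have /andP[_ h] := qform_line w (sgn_mean f (Some w)).
  apply: le_trans h _; apply: ler_wpM2r; last by have := q1; nra.
  by apply: sumr_ge0 => i _; apply: sqr_ge0.
have h4 : q ^+ 2 * (\sum_i G0 i ^+ 2 + \sum_w \sum_i sgn_mean f (Some w) i ^+ 2)
   <= q ^+ 2 * (N * \sum_x f x ^+ 2).
  by apply: ler_wpM2l => //; rewrite sqr_ge0.
rewrite -(sum_sgn_mean f) invfM; move: h1 h3 h4; rewrite -/G0; lra.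
Qed.

(** In this direction the line terms gain at most 1 and the geometry at most [q], a factor [q]
    better than the lower bound. *)
Lemma qform_adj_le (f : T -> R) :
  qform (fun x y => (adj x y)%:R) f <=
  (2 * q)^-1 * (\sum_x f x) ^+ 2 + (q * N / 2) * \sum_x f x ^+ 2.
Proof.
rewrite qform_adjE; set G0 := sgn_mean f None.
have h1 := qform_collinear_le G0; have h2 := sgn_mean_le f.
rewrite -/G0 in h2.
have h3 : - \sum_w \sum_i sgn_mean f (Some w) i ^+ 2 <=
  \sum_w qform (fun i i' => (line_base w i == line_base w i')%:R - (i == i')%:R)
   (sgn_mean f (Some w)).
  rewrite -sumrN; apply: ler_sum => w _ /=.
  by have /andP[] := qform_line w (sgn_mean f (Some w)).
have h4 : q * (\sum_i G0 i ^+ 2 + \sum_w \sum_i sgn_mean f (Some w) i ^+ 2)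
   <= q * (N * \sum_x f x ^+ 2).
  by apply: ler_wpM2l => //; rewrite ltW.
have h5 : \sum_w \sum_i sgn_mean f (Some w) i ^+ 2 <=
   q * \sum_w \sum_i sgn_mean f (Some w) i ^+ 2.
  rewrite ler_peMl ?(ltW q1) //; apply: sumr_ge0 => w _.
  by apply: sumr_ge0 => i _; apply: sqr_ge0.
rewrite -(sum_sgn_mean f) invfM; move: h1 h3 h4 h5; rewrite -/G0; lra.
Qed.

End Signs.
End AnisotropicForm.

Local Open Scope nat_scope.

(** * Containers in the tensor square *)

Section Pairs.
Variables (T : finType) (A : rel T).

Definition pair_adj (v w : T * T) : bool := A v.1 w.1 && A v.2 w.2.

Definition deg (U : {set T * T}) v := #|[set w in U | pair_adj v w]|.

Definition row_card (U : {set T * T}) x := #|[set y | (x, y) \in U]|.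

Definition col_card (U : {set T * T}) y := #|[set x | (x, y) \in U]|.

Lemma deg_subset (U U' : {set T * T}) v : U \subset U' -> deg U v <= deg U' v.
Proof.
move=> sUU'; apply: subset_leq_card; apply/subsetP=> w; rewrite !inE.
by case/andP=> /(subsetP sUU') -> ->.
Qed.

Lemma row_subset (U U' : {set T * T}) x : U \subset U' -> row_card U x <= row_card U' x.
Proof.
move=> sUU'; apply: subset_leq_card; apply/subsetP=> w; rewrite !inE.
exact: (subsetP sUU').
Qed.

Lemma col_subset (U U' : {set T * T}) x : U \subset U' -> col_card U x <= col_card U' x.
Proof.
move=> sUU'; apply: subset_leq_card; apply/subsetP=> w; rewrite !inE.
exact: (subsetP sUU').
Qed.

Lemma sum_row U : \sum_x row_card U x = #|U|.
Proof.
under eq_bigr => x _ do rewrite /row_card -sum1dep_card.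
by rewrite pair_big_dep -sum1_card; apply: eq_bigl => -[].
Qed.

Lemma sum_col U : \sum_y col_card U y = #|U|.
Proof.
under eq_bigr => x _ do rewrite /col_card -sum1dep_card.
rewrite (exchange_big_dep xpredT) //= pair_big_dep -sum1_card.
by apply: eq_bigl => -[].
Qed.

Lemma card_heavy (f : T -> nat) (D n : nat) :
  \sum_x f x <= n -> #|[set x | D < f x]| * D.+1 <= n.
Proof.
apply: leq_trans; rewrite -sum_nat_const [leqRHS](bigID (mem [set x | D < f x])) /=.
apply: leq_trans (leq_addr _ _); apply: leq_sum => x; by rewrite inE.
Qed.

(** Evaluate the tensor square of adjacency at the indicator of [U]. The squared row sums add up to
    at most [D * #|U|], likewise for columns, and multiplying by [4 * q ^ 2] clears the
    denominators. *)
Lemma edge_count (R : realFieldType) (q N D : nat) (U : {set T * T}) :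
  0 < q -> 0 < N -> symmetric A ->
  (forall f : T -> R, (2 * q%:R)^-1 * (\sum_x f x) ^+ 2
      - (q%:R ^+ 2 * N%:R / 2) * \sum_x f x ^+ 2 <= qform (fun x y => (A x y)%:R) f)%R ->
  (forall f : T -> R, qform (fun x y => (A x y)%:R) f <=
      (2 * q%:R)^-1 * (\sum_x f x) ^+ 2 + (q%:R * N%:R / 2) * \sum_x f x ^+ 2)%R ->
  (forall x, row_card U x <= D) -> (forall y, col_card U y <= D) ->
  #|U| ^ 2 <= 4 * q ^ 2 * (\sum_(v in U) deg U v)
              + #|U| * (2 * q ^ 3 * N * D + q ^ 5 * N ^ 2).
Proof.
move=> q0 N0 symA loA upA rowD colD.
pose u (x y : T) : R := ((x, y) \in U)%:R%R.
have Eu : (\sum_x \sum_y u x y = #|U|%:R)%R.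
  rewrite -sum_row natr_sum; apply: eq_bigr => x _.
  by rewrite /row_card -sum1_card natr_sum [RHS]big_mkcond; apply: eq_bigr => y _; rewrite inE /u; case: ifP.
have Eu2 : (\sum_x \sum_y u x y ^+ 2 = #|U|%:R)%R.
  rewrite -Eu; apply: eq_bigr => x _; apply: eq_bigr => y _.
  by rewrite /u; case: (_ \in _); rewrite /= ?expr1n ?expr0n.
have Erow x : (\sum_y u x y = (row_card U x)%:R)%R.
  by rewrite /row_card -sum1_card natr_sum [RHS]big_mkcond; apply: eq_bigr => y _; rewrite inE /u; case: ifP.
have Ecol y : (\sum_x u x y = (col_card U y)%:R)%R.
  by rewrite /col_card -sum1_card natr_sum [RHS]big_mkcond; apply: eq_bigr => x _; rewrite inE /u; case: ifP.
have le2 (f : T -> nat) : (forall x, f x <= D) -> \sum_x f x = #|U| ->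
    (\sum_x (f x)%:R ^+ 2 <= D%:R * #|U|%:R :> R)%R.
  move=> fD <-; rewrite natr_sum big_distrr; apply: ler_sum => x _ /=.
  by rewrite expr2 ler_wpM2r ?ler0n // ler_nat.
have Et : tensor_form (fun x y => (A x y)%:R : R)%R (fun x y => (A x y)%:R)%R u =
    ((\sum_(v in U) deg U v)%:R)%R.
  rewrite natr_sum [RHS]big_mkcond.
  transitivity (\sum_x \sum_y (if (x, y) \in U then (deg U (x, y))%:R else 0 : R))%R; last first.
    by rewrite pair_bigA; apply: eq_bigr => -[].
  apply: eq_bigr => x _; rewrite exchange_big; apply: eq_bigr => y _ /=.
  rewrite pair_bigA /= /u; case: ifP => xyU; last first.
    by rewrite big1 // => -[x' y'] _; rewrite !mul0r.
  rewrite /deg -sum1_card natr_sum [RHS]big_mkcond; apply: eq_bigr => -[x' y'] _ /=.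
  rewrite inE /pair_adj /= mul1r; case: (_ \in _); rewrite ?mulr0 // mulr1.
  by case: (A x x'); rewrite ?mul0r // mul1r; case: (A y y').
have qR : (0 < q%:R :> R)%R by rewrite ltr0n.
have NR : (0 < N%:R :> R)%R by rewrite ltr0n.
have := tensor_form_mean_ge u (ltW (_ : 0 < (2 * q%:R)^-1)%R)
  (_ : 0 < q%:R ^+ 2 * N%:R / 2)%R (_ : 0 < q%:R * N%:R / 2)%R _ loA upA.
rewrite Eu Eu2 Et; under [in X in (_ * (X + _))%R]eq_bigr do rewrite Erow.
under [in X in (_ * (_ + X))%R]eq_bigr do rewrite Ecol.
set n : R := (#|U|%:R)%R; set e : R := ((\sum_(v in U) deg U v)%:R)%R.
have := le2 _ rowD (sum_row U); have := le2 _ colD (sum_col U); rewrite -/n.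
set s1 := (\sum_x _)%R; set s2 := (\sum_x _)%R => h1 h2 h.
have {}h : ((2 * q%:R)^-1 ^+ 2 * n ^+ 2 -
   (2 * q%:R)^-1 * (q%:R ^+ 2 * N%:R / 2) * (s2 + s1) -
   q%:R ^+ 2 * N%:R / 2 * (q%:R * N%:R / 2) * n <= e)%R.
  apply: h => //; rewrite ?invr_gt0 ?divr_gt0 ?mulr_gt0 ?exprn_gt0 //.
  by move=> x y; rewrite symA.
rewrite -(ler_nat R) !(natrD, natrM, natrX) -/n -/e.
have c0 : (0 <= 4 * q%:R ^+ 2 :> R)%R by rewrite mulr_ge0 ?sqr_ge0.
have c1 : (0 <= q%:R ^+ 3 * N%:R :> R)%R by rewrite mulr_ge0 ?exprn_ge0 // ltW.
have := ler_wpM2l c0 h; have := ler_wpM2l c1 (lerD h1 h2).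
rewrite (_ : 4 * q%:R ^+ 2 * _ = n ^+ 2 - q%:R ^+ 3 * N%:R * (s1 + s2)
   - q%:R ^+ 5 * N%:R ^+ 2 * n)%R; last by field; rewrite gt_eqF.
set x := (q%:R ^+ 3 * N%:R * (s1 + s2))%R.
lra.
Qed.

End Pairs.

(** * The container algorithm *)

Section Containers.
Variables (T : finType) (A : rel T) (q N : nat).
Hypotheses (q0 : 0 < q) (N0 : 0 < N).
Notation Om := (T * T)%type.
Notation U := {set Om}.
Hypothesis edges : forall (C : U) D,
  (forall x, row_card C x <= D) -> (forall y, col_card C y <= D) ->
  #|C| ^ 2 <= 4 * q ^ 2 * (\sum_(v in C) deg A C v)
              + #|C| * (2 * q ^ 3 * N * D + q ^ 5 * N ^ 2).
(** Thresholds for the error terms of [edges]: [q ^ 5 * N ^ 2] is at most [#|C| / 16] once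
    [W <= #|C|], and [2 * q ^ 3 * N * D] at most [#|C| / 8] once [D <= #|C| / L]. *)
Let W := 16 * q ^ 5 * N ^ 2.
Let L := 16 * q ^ 3 * N.

Lemma L_gt0 : 0 < L. Proof. by rewrite /L 2!muln_gt0 expn_gt0 q0 N0. Qed.

Definition heavy (C : U) (f : T -> nat) : {set T} := [set x | #|C| %/ L < f x].

Definition low (C : U) : U := [set v in C | [&& v.1 \notin heavy C (row_card C),
  v.2 \notin heavy C (col_card C) & 16 * q ^ 2 * deg A C v < #|C|]].

Lemma card_heavy_le (C : U) f : \sum_x f x = #|C| -> #|heavy C f| <= L.
Proof.
move=> sf; have h := card_heavy (#|C| %/ L) (eq_leq sf).
rewrite leqNgt; apply/negP => lt.
have := ltn_ceil #|C| L_gt0; rewrite ltnNge => /negP[].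
apply: leq_trans h; by rewrite mulnC leq_mul2r ltnW ?orbT.
Qed.

(** Applied to the pruned set, [edges] bounds its size by a quarter (degrees), an eighth (rows and
    columns) and a sixteenth of [#|C|], together below one half. *)
Lemma card_low (C : U) : W <= #|C| -> 2 * #|low C| <= #|C|.
Proof.
move=> WC; set B := low C; set D := #|C| %/ L.
have sBC : B \subset C by apply/subsetP=> v; rewrite inE => /andP[].
have rowD x : row_card B x <= D.
  rewrite /row_card; have [->|[y]] := set_0Vmem [set y | (x, y) \in B]; first by rewrite cards0.
  rewrite !inE /= => /and4P[_ hx _ _]; rewrite leqNgt; apply: contra hx => hx.
  exact: leq_trans hx (row_subset _ sBC).
have colD y : col_card B y <= D.
  rewrite /col_card; have [->|[x]] := set_0Vmem [set x | (x, y) \in B]; first by rewrite cards0.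
  rewrite !inE /= => /and4P[_ _ hx _]; rewrite leqNgt; apply: contra hx => hx.
  exact: leq_trans hx (col_subset _ sBC).
have := edges rowD colD; set e := \sum_(v in B) _ => he.
have e_le : 16 * q ^ 2 * e <= #|B| * #|C|.
  rewrite big_distrr -sum_nat_const /=; apply: leq_sum => v vB.
  apply: leq_trans (_ : 16 * q ^ 2 * deg A C v <= _).
    by rewrite leq_mul2l deg_subset ?orbT.
  by move: vB; rewrite inE => /and4P[_ _ _ /ltnW].
have LD : L * D <= #|C| by rewrite mulnC leq_divM.
have [->|B0] := posnP #|B|; first by rewrite muln0.
move: LD WC; rewrite /L /W -(leq_pmul2l B0) -[16 * _ * _ <= _](leq_pmul2l B0).
set b := #|B| in B0 he e_le *; set c := #|C| in e_le *.
move=> LD WC; rewrite -(leq_pmul2l B0).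
move: he e_le LD WC; rewrite -!mulnA; nia.
Qed.

Lemma shrink_step (M c c' g : nat) : c' + g = c -> c <= M * g -> M * c' <= M.-1 * c.
Proof.
case: M => [|M] <- //=; rewrite mulSn addnC leq_add2l => h.
by rewrite mulSn mulnDr leq_add2r.
Qed.

Lemma halve_step (M b c : nat) : 1 < M -> 2 * b <= c -> M * b <= M.-1 * c.
Proof.
case: M => [|[|M]] //= _ h; rewrite -(leq_pmul2l (ltn0Sn 1)) mulnCA.
by apply: leq_trans (leq_mul (leqnn M.+2) h) _; rewrite mulnA leq_mul2r; lia.
Qed.

(** A state is a container with a set of exceptional first coordinates and a set of exceptional
    second coordinates. *)
Definition cover (S : U) (s : U * {set T} * {set T}) : bool :=
  [forall v in S, [|| v \in s.1.1, v.1 \in s.1.2 | v.2 \in s.2]].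

(** [Some v] records a member of the independent set, whose neighbours are discarded; [None] records
    that no member left in [C] has large degree, so [C] is pruned. States depend on the record
    alone, so counting records bounds the number of containers. *)
Definition step (s : U * {set T} * {set T}) (o : option Om) :=
  let: (C, X, Y) := s in
  match o with
  | Some v => (C :\: [set w | pair_adj A v w], X, Y)
  | None => (low C, X :|: heavy C (row_card C), Y :|: heavy C (col_card C))
  end.

Definition run (l : seq (option Om)) := foldl step (setT, set0, set0) l.

(* Each fingerprint step shrinks the container by the factor [1 - 1 / (16 q^2)], and each pruning step halves it. *)
Lemma container_run (J n : nat) (S : U) : #|T| ^ 2 < 2 ^ J * W ->
  {in S &, forall v w, ~~ pair_adj A v w} ->
  exists l, [/\ cover S (run l), size l <= n,
    exists2 i, i <= J & [/\ #|(run l).1.2| <= i * L, #|(run l).2| <= i * L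
      & 2 ^ i * #|(run l).1.1| <= #|T| ^ 2] &
    #|(run l).1.1| < W \/ size l = n /\
    (16 * q ^ 2) ^ n * #|(run l).1.1| <= (16 * q ^ 2).-1 ^ n * #|T| ^ 2].
Proof.
move=> J_big indS; elim: n => [|n [l [covS sl [i iJ [Xi Yi Ci]] Cl]]].
  exists [::]; split=> //=.
  - by apply/forall_inP=> v _; rewrite inE.
  - by exists 0; rewrite ?cards0 ?cardsT ?card_prod //= mul1n mulnn.
  - by right; rewrite !expn0 !mul1n cardsT card_prod mulnn.
have [|WC] := ltnP #|(run l).1.1| W; first by exists l; split=> //; [apply: leqW | exists i | left].
case: Cl => [|[szl Cl]]; first by rewrite ltnNge WC.
move: Xi Yi Ci covS WC Cl; case Dl: (run l) => [[C X] Y] /= Xi Yi Ci covS WC Cl.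
have [/exists_inP[v vS /andP[vC dv]] | nohigh] := boolP [exists v in S, (v \in C) && (#|C| <= 16 * q ^ 2 * deg A C v)].
  exists (rcons l (Some v)); rewrite /run foldl_rcons -/(run l) Dl /= size_rcons szl ltnS.
  have cardC : #|C :\: [set w | pair_adj A v w]| + deg A C v = #|C|.
    rewrite -(cardsID [set w | pair_adj A v w] C) addnC; congr (_ + _).
    by apply: eq_card => w; rewrite !inE.
  split=> //.
  - apply/forall_inP=> w wS; have := forall_inP covS w wS; rewrite /= !inE.
    by rewrite (negPf (indS v w vS wS)).
  - exists i => //; split=> //; apply: leq_trans Ci; rewrite leq_mul2l.
    by rewrite -cardC leq_addr orbT.
  right; split=> //; rewrite ![_ ^ n.+1]expnS.
  apply: (@leq_trans ((16 * q ^ 2) ^ n * ((16 * q ^ 2).-1 * #|C|))).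
    rewrite [16 * q ^ 2 * _]mulnC -mulnA; apply: leq_mul => //.
    exact: shrink_step cardC dv.
  by rewrite mulnCA -mulnA; apply: leq_mul.
exists (rcons l None); rewrite /run foldl_rcons -/(run l) Dl /= size_rcons szl ltnS.
have lowC := card_low WC.
(* While [C] has at least [W] elements, fewer than [J] prunings can have occurred. *)
have iJ' : i < J.
  rewrite -(ltn_exp2l _ _ (ltnSn 1)) -(ltn_pmul2r (_ : 0 < W)); last first.
    by rewrite /W 2!muln_gt0 !expn_gt0 q0 N0.
  by apply: leq_ltn_trans J_big; apply: leq_trans Ci; rewrite leq_mul2l WC orbT.
split=> //.
- apply/forall_inP=> v vS; have /= := forall_inP covS v vS; rewrite in_setU.
  case/or3P=> [vC|->|vY]; rewrite ?orbT //; last by rewrite [v.2 \in _ :|: _]in_setU vY /= !orbT.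
  rewrite [v.2 \in _ :|: _]in_setU inE vC /=.
  case: (v.1 \in heavy _ _); rewrite ?orbT //=.
  case: (v.2 \in heavy _ _); rewrite ?orbT //=.
  rewrite ltnNge; apply/orP; left; apply: contra nohigh => dv.
  by apply/exists_inP; exists v; rewrite ?vC.
- exists i.+1 => //; split.
  + rewrite (leq_trans (leq_card_setU _ _)) // mulSn addnC leq_add // card_heavy_le //.
    exact: sum_row.
  + rewrite (leq_trans (leq_card_setU _ _)) // mulSn addnC leq_add // card_heavy_le //.
    exact: sum_col.
  + by rewrite expnS; apply: leq_trans Ci; rewrite [2 * _]mulnC -mulnA leq_mul2l lowC orbT.
right; split=> //; rewrite ![_ ^ n.+1]expnS.
apply: (@leq_trans ((16 * q ^ 2) ^ n * ((16 * q ^ 2).-1 * #|C|))).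
  rewrite [16 * q ^ 2 * _]mulnC -mulnA; apply: leq_mul => //.
  apply: halve_step lowC; rewrite -[2]/(2 * 1); apply: leq_mul => //.
  by rewrite expn_gt0 q0.
by rewrite mulnCA -mulnA; apply: leq_mul.
Qed.

(** Columns with more than [D] entries become exceptional; a container with fewer than [W] elements
    has at most [W / D.+1] of them. *)
Definition trim (D : nat) (s : U * {set T} * {set T}) :=
  ([set v in s.1.1 | col_card s.1.1 v.2 <= D], s.1.2, s.2 :|: [set y | D < col_card s.1.1 y]).

Lemma container_family (J n D M : nat) :
  #|T| ^ 2 < 2 ^ J * W ->
  (16 * q ^ 2).-1 ^ n * #|T| ^ 2 < (16 * q ^ 2) ^ n * W ->
  W <= M * D.+1 ->
  exists c : n.-tuple (option (option Om)) -> U * {set T} * {set T},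
    (forall i, [/\ forall y, col_card (c i).1.1 y <= D, #|(c i).1.2| <= J * L
       & #|(c i).2| <= J * L + M]) /\
    (forall S : U, {in S &, forall v w, ~~ pair_adj A v w} ->
       exists i, cover S (c i)).
Proof.
move=> TW TnW WM.
pose ok (s : U * {set T} * {set T}) := [&& [forall y, col_card s.1.1 y <= D],
  #|s.1.2| <= J * L & #|s.2| <= J * L + M].
pose c (i : n.-tuple (option (option Om))) :=
  (* Records that break the bounds get the empty state, so the bounds hold for every index. The
     outer [None], dropped by [pmap id], pads short runs to length [n]. *)
  let s := trim D (run (pmap id i)) in if ok s then s else (set0, set0, set0).
have col0 y : col_card set0 y = 0 by rewrite /col_card; apply: eq_card0 => x; rewrite !inE.
exists c; split=> [i | S indS].
  rewrite /c; case: ifP => [/and3P[/forallP] //|_]; rewrite /= !cards0.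
  by split=> // y; rewrite col0.
have [l [covS szl [i iJ [Xi Yi _]] Cl]] := container_run n TW indS.
have CW : #|(run l).1.1| < W.
  case: Cl => // -[_ Cl]; rewrite ltnNge; apply/negP => WC.
  move: TnW; rewrite ltnNge => /negP[]; apply: leq_trans Cl.
  by rewrite leq_mul2l WC orbT.
have szt : size (map Some l ++ nseq (n - size l) None) == n.
  by rewrite size_cat size_map size_nseq subnKC.
exists (Tuple szt); rewrite /c /= pmap_cat.
have -> : pmap id (nseq (n - size l) (None : option (option Om))) = [::].
  by elim: (n - size l).
rewrite cats0 (_ : pmap id [seq Some i | i <- l] = l); last by elim: (l) => //= o l' ->.
case Dl: (run l) Xi Yi CW covS => [[C X] Y] /= Xi Yi CW covS.
have iL : i * L <= J * L by rewrite leq_mul2r iJ orbT.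
rewrite ifT.
  apply/forall_inP=> v vS; have := forall_inP covS v vS; rewrite /= !inE.
  case: (leqP (col_card C v.2) D); rewrite ?andbT ?orbT ?orbF //=.
apply/and3P; split=> /=.
- apply/forallP=> y; have [yD|Dy] := leqP (col_card C y) D.
    by apply: leq_trans yD; apply/col_subset/subsetP=> v; rewrite inE => /andP[].
  rewrite (_ : col_card _ y = 0) //; apply: eq_card0 => x; rewrite !inE /=.
  by rewrite leqNgt Dy andbF.
- exact: leq_trans iL.
rewrite (leq_trans (leq_card_setU _ _)) // leq_add //; first exact: leq_trans iL.
rewrite -(leq_pmul2r (ltn0Sn D)); apply: leq_trans (card_heavy D _) _.
- exact/eq_leq/sum_col.
- exact: leq_trans (ltnW CW) WM.
Qed.

End Containers.

(** * Random samples *)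

Section Sampling.
Variables (T : finType) (n : nat).
Notation Phi := {ffun 'I_n -> T}.

(** Once the values off [B] are fixed, so are the sections, and each index of [B] has at most [c]
    choices. *)
Lemma card_sections (B : {set 'I_n}) (Sec : 'I_n -> Phi -> {set T}) (c : nat) :
  (forall f f' : Phi, (forall i, i \notin B -> f i = f' i) ->
     forall b, b \in B -> Sec b f = Sec b f') ->
  (forall b f, b \in B -> #|Sec b f| <= c) ->
  #|[set f : Phi | [forall b in B, f b \in Sec b f]]| <= c ^ #|B| * #|T| ^ (n - #|B|).
Proof.
move=> SecE Secc; set Z := [set f | _].
have [->|[f0 f0Z]] := set_0Vmem Z; first by rewrite cards0.
have [n0|/card_gt0P[i0 _]] := posnP #|'I_n|.
  have -> : B = set0.
    by apply/setP=> i; have := card0_eq n0 i; rewrite inE.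
  rewrite cards0 subn0 mul1n -[n in _ ^ n]card_ord -card_ffun; exact: max_card.
pose t0 := f0 i0.
pose off (f : Phi) : Phi := [ffun i => if i \in B then t0 else f i].
have -> : #|T| ^ (n - #|B|) = #|pffun_on t0 (~: B) (@predT T)|.
  have cB : #|~: B| = n - #|B| by rewrite -(addKn #|B| #|~: B|) cardsC card_ord.
  by rewrite card_pffun_on cB.
rewrite mulnC -sum_nat_const -sum1_card.
rewrite (partition_big off [in pffun_on t0 (~: B) predT]) /= => [|f _]; last first.
  apply/pffun_onP; split=> [|x /imageP[i _ ->]//].
  apply/supportP=> i; rewrite inE negbK ffunE => ->; done.
apply: leq_sum => g _; rewrite sum1dep_card.
pose Fam i := if i \in B then Sec i g else [set g i].
apply: (@leq_trans #|(family Fam : simpl_pred Phi)|).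
  apply: subset_leq_card; apply/subsetP=> f; rewrite !inE => /andP[/forall_inP fS /eqP offf].
  apply/familyP=> i; rewrite /Fam -offf; case: ifPn => iB; last by rewrite ffunE (negPf iB) inE.
  rewrite -(SecE f) ?fS // => k kB; by rewrite ffunE (negPf kB).
rewrite card_family foldrE big_map big_enum /= (bigID (mem B)) /=.
rewrite [X in _ * X <= _]big1 => [|i iB]; last by rewrite /Fam (negPf iB) cards1.
rewrite muln1 -prod_nat_const; apply: leq_prod => i iB.
by rewrite /Fam iB Secc.
Qed.

Variables (A : rel T).

(* The pairs [(b i, w i)] are the black and white vertices of an odd clique minor with bags of size 2 in the complement. *)
Definition spoiled (k : nat) (f : Phi) (b w : 'I_k -> 'I_n) : Prop :=
  [/\ injective b, injective w, forall i i', b i != w i' &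
    forall i i', i != i' -> ~~ (A (f (b i)) (f (b i')) && A (f (w i)) (f (w i')))].

Hypothesis A_irr : irreflexive A.

Lemma card_exists_le (I Z : finType) (P : pred I) (F : I -> {set Z}) (c : nat) :
  (forall i, P i -> #|F i| <= c) ->
  #|[set z | [exists i, P i && (z \in F i)]]| <= #|P| * c.
Proof.
move=> Fc; rewrite -sum_nat_const -sum1_card.
apply: (@leq_trans (\sum_(i in P) \sum_(z in F i) 1)); last first.
  by apply: leq_sum => i Pi; rewrite sum1_card Fc.
rewrite (exchange_big_dep xpredT) //= big_mkcond; apply: leq_sum => z _.
rewrite inE; case: existsP => // -[i /andP[Pi zi]].
rewrite (bigD1 i) /=; last by rewrite unfold_in Pi zi.
by [].
Qed.

Lemma card_set_ordinal : #|{: {set 'I_n}}| = 2 ^ n.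
Proof. by have := card_powerset [set: 'I_n]; rewrite powersetT !cardsT card_ord. Qed.

Lemma exists_subset_card (Z : finType) (C : {set Z}) k : k <= #|C| ->
  exists2 B : {set Z}, B \subset C & #|B| = k.
Proof.
move=> /card_geqP[s [us <- sC]]; exists [set x in s].
  by apply/subsetP=> x; rewrite inE => /sC.
by rewrite cardsE; apply/card_uniqP.
Qed.

Definition hits (k : nat) (X : {set T}) : {set Phi} :=
  [set f | [exists B : {set 'I_n}, (#|B| == k) && (f \in
     [set f : Phi | [forall b in B, f b \in X]])]].

Lemma card_hits k (X : {set T}) M : #|X| <= M -> #|hits k X| <= 2 ^ n * (M ^ k * #|T| ^ (n - k)).
Proof.
move=> XM; apply: leq_trans (card_exists_le (c := M ^ k * #|T| ^ (n - k)) _) _.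
  by move=> B /eqP Bk; rewrite -Bk; apply: (card_sections (Sec := fun _ _ => X)).
by rewrite leq_mul2r -card_set_ordinal max_card orbT.
Qed.

(** The partner map [g] sends [B] outside [B], so the section at each [b] depends only on values off
    [B]. Fixing [g] to [i0] off [B] leaves at most [n ^ k] maps. *)
Definition pair_hits (k : nat) (i0 : 'I_n) (C : {set T * T}) : {set Phi} :=
  [set f | [exists B : {set 'I_n}, (#|B| == k) && (f \in
     [set f | [exists g : {ffun 'I_n -> 'I_n},
        ((g \in pffun_on i0 B predT) && [forall b in B, g b \notin B]) && (f \in
        [set f : Phi | [forall b in B, f b \in [set x | (x, f (g b)) \in C]]])]])]].

Lemma card_pair_hits k i0 (C : {set T * T}) D : (forall y, col_card C y <= D) ->
  #|pair_hits k i0 C| <= 2 ^ n * (n ^ k * (D ^ k * #|T| ^ (n - k))).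
Proof.
move=> CD; apply: leq_trans (card_exists_le (c := n ^ k * (D ^ k * #|T| ^ (n - k))) _) _.
  move=> B /eqP Bk.
  apply: leq_trans (card_exists_le (c := D ^ k * #|T| ^ (n - k)) _) _.
    move=> g /andP[_ /forall_inP gB]; rewrite -Bk.
    apply: (card_sections (Sec := fun b (f : Phi) => [set x | (x, f (g b)) \in C])).
      by move=> f f' ff' b bB; rewrite ff' ?gB.
    by move=> b f _; apply: CD.
  rewrite leq_mul2r; apply/orP; right.
  rewrite -[n in n ^ k]card_ord -Bk -(card_pffun_on i0 B (@predT 'I_n)).
  by apply: subset_leq_card; apply/subsetP=> g /andP[].
by rewrite leq_mul2r -card_set_ordinal max_card orbT.
Qed.

(** Each of the [3 * k] pairs lies in the container or has an exceptional first or second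
    coordinate; one of the three cases occurs at least [k] times. *)
Lemma spoiled_hits (I : finType) (c : I -> {set T * T} * {set T} * {set T})
    (k : nat) (i0 : 'I_n) (f : Phi) (b w : 'I_(3 * k) -> 'I_n) :
  (forall S : {set T * T}, {in S &, forall v w, ~~ pair_adj A v w} ->
     exists i, cover S (c i)) ->
  spoiled f b w -> exists i, [|| f \in pair_hits k i0 (c i).1.1,
     f \in hits k (c i).1.2 | f \in hits k (c i).2].
Proof.
move=> covP [injb injw bw indep].
pose S := [set (f (b j), f (w j)) | j : 'I_(3 * k)].
have [v v'|i /forall_inP covS] := covP S.
  move=> /imsetP[j _ ->] /imsetP[j' _ ->]; rewrite /pair_adj /=.
  by have [<-|jj'] := eqVneq j j'; [rewrite A_irr | apply: indep].
exists i; pose I1 := [set j | (f (b j), f (w j)) \in (c i).1.1].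
pose I2 := [set j | f (b j) \in (c i).1.2]; pose I3 := [set j | f (w j) \in (c i).2].
have : 3 * k <= #|I1| + #|I2| + #|I3|.
  rewrite -[X in X <= _]card_ord -cardsT.
  apply: leq_trans (_ : #|I1 :|: I2 :|: I3| <= _); last first.
    apply: leq_trans (leq_card_setU _ _) _; rewrite leq_add2r; exact: leq_card_setU.
  apply: subset_leq_card; apply/subsetP=> j _; rewrite !inE -orbA.
  exact: (covS _ (imset_f _ _)).
have hit (h : 'I_(3 * k) -> 'I_n) (X : {set T}) : injective h -> k <= #|[set j | f (h j) \in X]| ->
    f \in hits k X.
  move=> injh /exists_subset_card[J /subsetP sJ cJ]; rewrite inE; apply/existsP.
  exists (h @: J); rewrite card_imset // cJ eqxx inE /=; apply/forall_inP=> x.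
  by case/imsetP=> j /sJ; rewrite inE => fj ->.
have [k1 _|k1 h] := leqP k #|I1|; last first.
  have [k2|k2] := leqP k #|I2|; first by rewrite (hit _ _ injb k2) orbT.
  have k3 : k <= #|I3|.
    by move: #|I1| #|I2| #|I3| h k1 k2 => n1 n2 n3; lia.
  by rewrite (hit _ _ injw k3) !orbT.
apply/orP; left; have [J /subsetP sJ cJ] := exists_subset_card k1.
pose g : {ffun 'I_n -> 'I_n} :=
  [ffun x => if [pick j in J | b j == x] is Some j then w j else i0].
have gE j : j \in J -> g (b j) = w j.
  move=> jJ; rewrite ffunE; case: pickP => [j' /andP[_ /eqP/injb -> //]|/(_ j)].
  by rewrite jJ eqxx.
rewrite inE; apply/existsP; exists (b @: J); rewrite card_imset // cJ eqxx inE /=.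
apply/existsP; exists g; rewrite inE -andbA; apply/and3P; split.
- apply/pffun_onP; split=> //; apply/supportP=> x xJ; rewrite ffunE.
  case: pickP => // j /andP[jJ /eqP bj]; case/negP: xJ; rewrite -bj; exact: imset_f.
- apply/forall_inP=> x /imsetP[j jJ ->]; rewrite gE //; apply/imsetP=> -[j' _ E].
  by have := bw j' j; rewrite E eqxx.
rewrite inE; apply/forall_inP=> x /imsetP[j jJ ->]; rewrite gE // inE.
by have := sJ j jJ; rewrite inE.
Qed.

(* A spoiled sample is caught by some container, whose dense part leaves few choices for the partner of each point and whose two exceptional sets are rarely hit. *)
Lemma exists_unspoiled (I : finType) (c : I -> {set T * T} * {set T} * {set T})
    (k h D M : nat) :
  (forall i, [/\ forall y, col_card (c i).1.1 y <= D, #|(c i).1.2| <= M & #|(c i).2| <= M]) ->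
  (forall S : {set T * T}, {in S &, forall v w, ~~ pair_adj A v w} ->
     exists i, cover S (c i)) ->
  0 < n -> 0 < #|T| -> k <= n -> n <= h * k ->
  n * D * 2 ^ (3 * h) <= #|T| -> M * 2 ^ (3 * h) <= #|T| ->
  3 * #|I| < 2 ^ (2 * n) ->
  exists f : Phi, forall b w : 'I_(3 * k) -> 'I_n, ~ spoiled f b w.
Proof.
move=> cP covP n0 T0 kn nhk nD MD Ismall.
pose i0 := Ordinal n0.
pose bad i := pair_hits k i0 (c i).1.1 :|: hits k (c i).1.2 :|: hits k (c i).2.
have [f fgood] : exists f : Phi, forall i, f \notin bad i.
  suff /existsP[f /forallP fP] : [exists f : Phi, [forall i, f \notin bad i]] by exists f.
  apply: contraLR Ismall => /existsPn allbad; rewrite -leqNgt.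
  have k0 : 0 < k by case: (k) nhk; rewrite ?muln0 // leqNgt n0.
  (* Since [n <= h * k], the saving [2 ^ (3 * h * k)] is at least [2 ^ (3 * n)]: a factor [2 ^ n]
     pays for the choice of [B], and [2 ^ (2 * n)] is left for the union over the containers. *)
  have small a : a * 2 ^ (3 * h) <= #|T| ->
      2 ^ n * (a ^ k * #|T| ^ (n - k)) * 2 ^ (2 * n) <= #|T| ^ n.
    move=> aT; rewrite -[n in leqRHS](subnKC kn) expnD mulnAC !mulnA leq_mul //.
    apply: (@leq_trans ((2 ^ (3 * h)) ^ k * a ^ k)); last first.
      by rewrite mulnC -expnMn leq_exp2r.
    rewrite leq_mul // -expnD -expnM leq_exp2l // -mulnA; lia.
  have badi i : #|bad i| * 2 ^ (2 * n) <= 3 * #|T| ^ n.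
    have [colD XM YM] := cP i.
    rewrite (_ : 3 * _ = #|T| ^ n + #|T| ^ n + #|T| ^ n); last lia.
    apply: (@leq_trans ((#|pair_hits k i0 (c i).1.1| + #|hits k (c i).1.2| +
       #|hits k (c i).2|) * 2 ^ (2 * n))).
      rewrite leq_mul2r; apply/orP; right.
      apply: leq_trans (leq_card_setU _ _) _; rewrite leq_add2r; exact: leq_card_setU.
    rewrite !mulnDl; apply: leq_add; first apply: leq_add.
    - apply: leq_trans (small _ nD); rewrite leq_mul2r; apply/orP; right.
      rewrite expnMn -mulnA; exact: card_pair_hits.
    - apply: leq_trans (small _ MD); rewrite leq_mul2r; apply/orP; right.
      exact: card_hits.
    - apply: leq_trans (small _ MD); rewrite leq_mul2r; apply/orP; right.
      exact: card_hits.
  have p0 : 0 < 2 ^ (2 * n) by rewrite expn_gt0.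
  have all_f : #|T| ^ n <= #|I| * (3 * #|T| ^ n %/ 2 ^ (2 * n)).
    rewrite -[n in leqLHS]card_ord -card_ffun.
    apply: leq_trans (card_exists_le (P := predT) (F := bad) _); last first.
      by move=> i _; rewrite leq_divRL.
    apply: subset_leq_card; apply/subsetP=> f _; rewrite inE.
    by have := allbad f; rewrite negb_forall => /existsP[i /negPn fi]; apply/existsP; exists i.
  have Tn : 0 < #|T| ^ n by rewrite expn_gt0 T0.
  rewrite -(leq_pmul2l Tn); apply: leq_trans (leq_mul all_f (leqnn _)) _.
  rewrite -mulnA; apply: leq_trans (leq_mul (leqnn _) (leq_divM _ _)) _.
  by rewrite mulnA mulnC [#|I| * 3]mulnC.
exists f => b w /(spoiled_hits i0 covP)[i fi]; case/negP: (fgood i).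
by rewrite /bad !in_setU -orbA.
Qed.

End Sampling.

(** * The complement of the sample *)

Section SampledGraph.
Variables (T : finType) (A : rel T) (n : nat) (f : {ffun 'I_n -> T}).
Hypothesis A_sym : symmetric A.
Hypothesis A_tf : forall x y z, A x y -> A y z -> A x z -> False.

Definition nonadj (x y : 'I_n) : bool := (x != y) && ~~ A (f x) (f y).

Lemma nonadj_simple : simple_graph nonadj.
Proof.
split=> [x y|x]; last by rewrite /nonadj eqxx.
by rewrite /nonadj eq_sym A_sym.
Qed.

(** Three vertices in one colour class would give a triangle of [A]. *)
Lemma colorable_nonadj k : colorableb nonadj k -> n <= 2 * k.
Proof.
move=> /existsP[col /forallP colP].
have class2 (a : 'I_k) : #|[set x | col x == a]| <= 2.
  rewrite leqNgt; apply/card_gt2P => -[x [y [z [[xa ya za] [xy yz zx]]]]].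
  move: xa ya za; rewrite !inE => /eqP xa /eqP ya /eqP za.
  have adj u v : u != v -> col u = a -> col v = a -> A (f u) (f v).
    move=> uv ua va; have /forallP/(_ v) := colP u.
    by rewrite ua va eqxx implybF /nonadj uv negbK.
  by apply: (A_tf (adj x y xy xa ya) (adj y z yz ya za)); apply: adj; rewrite // eq_sym.
rewrite -[X in X <= _]card_ord -sum1_card (partition_big col predT) //=.
rewrite mulnC -[X in _ <= X * _]card_ord -sum_nat_const; apply: leq_sum => a _.
rewrite sum1dep_card; exact: class2.
Qed.

Lemma chromatic_nonadj : n <= 2 * chromatic_number nonadj.
Proof.
(* Abstracting the proof inside [boolP] allows case analysis; the default branch has value [n]. *)
have either (P : Prop) b b' (s : alt_spec P b b') (g : P -> nat) (d : nat) :
    (forall h, n <= 2 * g h) -> n <= 2 * d ->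
    n <= 2 * (match s with AltTrue h => g h | AltFalse _ => d end) by case: s.
apply: either => [h|]; first by case: ex_minnP => k /colorable_nonadj.
by rewrite card_ord mul2n -addnn leq_addr.
Qed.

Lemma injection_into (Z : finType) (C : {set Z}) m : m <= #|C| ->
  exists2 g : 'I_m -> Z, injective g & forall i, g i \in C.
Proof.
move=> mC; exists (fun i => enum_val (widen_ord mC i)) => [i j|i].
  by move/enum_val_inj/(congr1 val) => /= ij; apply: val_inj.
exact: enum_valP.
Qed.

Variable k : nat.
Hypothesis unspoiled : forall b w : 'I_(3 * k) -> 'I_n, ~ spoiled A f b w.

(** * Counting the small bags of an odd minor *)

Section Minor.
Variables (t : nat) (V : 'I_t -> {set 'I_n}) (F : 'I_t -> rel 'I_n).
Variable c : 'I_t -> 'I_n -> bool.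
Hypothesis disj : forall i j, i != j -> [disjoint V i & V j].
Hypothesis treeF : forall i, is_tree (V i) (F i).
Hypothesis properF : forall i x y, F i x y -> c i x != c i y.
Hypothesis linked : forall i j, i != j ->
  exists x y, [/\ x \in V i, y \in V j, nonadj x y & c i x = c j y].

Lemma bag_disjoint i j x y : x \in V i -> y \in V j -> i != j -> x != y.
Proof.
move=> xi yj /disj /pred0P/(_ x); rewrite /= xi /=.
by apply: contraFN => /eqP ->.
Qed.

(** Vertices of distinct singleton bags are non-adjacent in [A], so [6 * k] of them, split into
    halves and matched arbitrarily, give a spoiled family. *)
Lemma few_singletons : #|[set i | #|V i| == 1]| < 3 * k + 3 * k.
Proof.
rewrite ltnNge; apply/negP => /injection_into[g injg gP].
have [v vP] : exists v : 'I_(3 * k + 3 * k) -> 'I_n, forall j, V (g j) = [set v j].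
  by apply: (fin_all_exists (P := fun j v => V (g j) = [set v])) => j; apply/cards1P; have := gP j; rewrite inE.
have vin j : v j \in V (g j) by rewrite vP set11.
have injv : injective v.
  move=> j j' vv; apply/eqP/negPn/negP => jj'.
  have := bag_disjoint (vin j) (vin j'); rewrite vv eqxx.
  by rewrite (inj_eq injg) => /(_ jj').
apply: (unspoiled (b := fun j => v (lshift _ j)) (w := fun j => v (rshift _ j))).
split=> [j j' /injv/lshift_inj //|j j' /injv/rshift_inj //|j j'|j j' jj'].
  by rewrite (inj_eq injv) eq_lrshift.
have [x [y []]] : exists x y, [/\ x \in V (g (lshift _ j)), y \in V (g (lshift _ j')),
   nonadj x y & c (g (lshift _ j)) x = c (g (lshift _ j')) y].
  by apply: linked; rewrite (inj_eq injg) (inj_eq (@lshift_inj _ _)).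
by rewrite !vP !inE => /eqP -> /eqP -> /andP[_ /negPf ->].
Qed.

Lemma pair_bag i : #|V i| == 2 ->
  exists p, [/\ V i = [set p.1; p.2], c i p.1 & ~~ c i p.2].
Proof.
move=> /cards2P[x [y [xy Vi]]].
have [_ _ FV conn _] := treeF i.
have cxy : c i x != c i y.
  have xV : x \in V i by rewrite Vi !inE eqxx.
  have yV : y \in V i by rewrite Vi !inE eqxx orbT.
  have /connectP[[|z p] /= pth yl] := conn x y xV yV; first by rewrite yl eqxx in xy.
  case/andP: pth => Fxz _; have := properF Fxz.
  have /andP[_] := FV _ _ Fxz; rewrite Vi !inE => /orP[]/eqP -> //.
  by rewrite eqxx.
case: (boolP (c i x)) cxy => cx cy.
  by exists (x, y); split=> //=; apply: contra cy => ->.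
exists (y, x); split=> //=; first by rewrite Vi setUC.
by move: cy; case: (c i y).
Qed.

(** A link between two bags of size 2 joins equal colours, so the two black or the two white
    vertices are non-adjacent in [A]. *)
Lemma few_pairs : #|[set i | #|V i| == 2]| < 3 * k.
Proof.
rewrite ltnNge; apply/negP => /injection_into[g injg gP].
have [p pP] : exists p : 'I_(3 * k) -> 'I_n * 'I_n, forall j,
    [/\ V (g j) = [set (p j).1; (p j).2], c (g j) (p j).1 & ~~ c (g j) (p j).2].
  by apply: (fin_all_exists (P := fun j p => [/\ V (g j) = [set p.1; p.2],
      c (g j) p.1 & ~~ c (g j) p.2])) => j; apply: pair_bag; have := gP j; rewrite inE.
have bin j : (p j).1 \in V (g j) by have [-> _ _] := pP j; rewrite !inE eqxx.
have win j : (p j).2 \in V (g j) by have [-> _ _] := pP j; rewrite !inE eqxx orbT.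
have inj (h : 'I_(3 * k) -> 'I_n) : (forall j, h j \in V (g j)) -> injective h.
  move=> hin j j' hh; apply/eqP/negPn/negP => jj'.
  by have := bag_disjoint (hin j) (hin j'); rewrite hh eqxx (inj_eq injg) => /(_ jj').
apply: (unspoiled (b := fun j => (p j).1) (w := fun j => (p j).2)).
split=> [||j j'|j j' jj']; [exact: inj bin | exact: inj win | |].
  have [<-|jj'] := eqVneq j j'.
    by have [_ cb cw] := pP j; apply: contraNneq cw => <-.
  by apply: bag_disjoint (bin j) (win j') _; rewrite (inj_eq injg).
have [x [y []]] : exists x y, [/\ x \in V (g j), y \in V (g j'),
   nonadj x y & c (g j) x = c (g j') y].
  by apply: linked; rewrite (inj_eq injg).
have [-> cb cw] := pP j; have [-> cb' cw'] := pP j'.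
rewrite !inE => /orP[]/eqP -> /orP[]/eqP -> /andP[_ /negPf nA].
- by rewrite nA.
- by rewrite cb (negPf cw').
- by rewrite cb' (negPf cw).
- by rewrite nA andbF.
Qed.

Lemma sum_bags : \sum_i #|V i| <= n.
Proof.
under eq_bigr => i _ do rewrite -sum1_card.
rewrite (exchange_big_dep xpredT) //= -[X in _ <= X]card_ord -sum1_card.
apply: leq_sum => x _; rewrite sum1dep_card.
apply/card_le1_eqP => i j; rewrite !inE => xi xj.
apply/eqP/negPn/negP => ij; have := bag_disjoint xj xi ij.
by rewrite eqxx.
Qed.

(** A singleton bag is two vertices short of three, and a pair one short; the total shortage is
    below [2 * (6 * k) + 3 * k = 15 * k]. *)
Lemma minor_order : 3 * t < n + 15 * k.
Proof.
have bag i : 3 <= #|V i| + (#|V i| == 1) + (#|V i| == 1) + (#|V i| == 2).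
  have [V0 _ _ _ _] := treeF i; rewrite -cards_eq0 in V0.
  by case: #|V i| V0 => [|[|[|?]]].
have : 3 * t <= \sum_i (#|V i| + (#|V i| == 1) + (#|V i| == 1) + (#|V i| == 2)).
  by rewrite mulnC -[X in X * _ <= _]card_ord -sum_nat_const; apply: leq_sum.
rewrite !big_split /=.
have count j : \sum_i (#|V i| == j) = #|[set i | #|V i| == j]|.
  by rewrite -sum1dep_card [RHS]big_mkcond; apply: eq_bigr => i _; case: (_ == _).
rewrite !count; have := few_singletons; have := few_pairs; have := sum_bags.
by move: #|_| #|_| (\sum_i _) => s1 s2 s; lia.
Qed.

End Minor.

Lemma no_odd_minor t : n + 15 * k <= 3 * t -> ~ has_odd_minor_K nonadj t.
Proof.
move=> nt [V [F [c [disj tree _ proper link]]]].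
have := minor_order disj tree proper link; rewrite ltnNge nt; exact: notF.
Qed.

End SampledGraph.

(** * Choice of the parameters *)

(** The map [x ^+ 2 + x] vanishes at both 0 and 1, so on a finite field it is not surjective. *)
Lemma exists_anisotropic k : 0 < k -> exists (F : finFieldType) (d : F),
  [/\ #|F| = 2 ^ k, (2 = 0 :> F)%R & forall x : F, (x ^+ 2 + x != d)%R].
Proof.
move=> k0; have [F charF cardF] := pPrimePowerField (isT : prime 2) k0.
have two0 := pcharf0 charF.
pose g (x : F) := (x ^+ 2 + x)%R.
have [d dP] : exists d, d \notin codom g.
  apply/existsP; apply: contraT => /existsPn gs.
  have : #|codom g| == #|F| by apply/eqP/eq_card => d; rewrite -[_ \in _]negbK gs.
  move=> /image_injP/(_ 0%R 1%R isT isT); rewrite /g expr0n expr1n addr0 => /(_ (esym two0)).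
  by move/esym/eqP; rewrite oner_eq0.
exists F, d; split=> // x; apply: contraNneq dP => <-; exact: codom_f.
Qed.

Lemma exists_code (W : finType) j : #|W| < 2 ^ j ->
  exists2 code : option W -> {ffun 'I_j -> bool},
    injective code & code None = [ffun => false].
Proof.
rewrite -card_option -[j in 2 ^ j]card_ord -card_bool -card_ffun => le.
pose c0 (o : option W) : {ffun 'I_j -> bool} := enum_val (widen_ord le (enum_rank o)).
have c0_inj : injective c0.
  by move=> o o' /enum_val_inj/(congr1 val) /= h; apply/enum_rank_inj/val_inj.
exists (fun o => [ffun i => c0 o i (+) c0 None i]) => [o o' /ffunP h|].
  by apply: c0_inj; apply/ffunP=> i; have := h i; rewrite !ffunE => /addIb.
by apply/ffunP=> i; rewrite !ffunE addbb.
Qed.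

(** The [2 * k + 1] sign bits give distinct codes to the [q ^ 2] directions and the trivial
    character. *)
Lemma exists_kernel k (q := 2 ^ k) (N := 2 ^ (2 * k).+1) : 0 < k ->
  exists (T : finType) (A : rel T),
  [/\ symmetric A, irreflexive A, forall x y z, A x y -> A y z -> A x z -> False,
     #|T| = q ^ 4 * N &
     forall (C : {set T * T}) D, (forall x, row_card C x <= D) -> (forall y, col_card C y <= D) ->
       #|C| ^ 2 <= 4 * q ^ 2 * (\sum_(v in C) deg A C v)
              + #|C| * (2 * q ^ 3 * N * D + q ^ 5 * N ^ 2)].
Proof.
move=> k0; have [F [d [cardF two0 dP]]] := exists_anisotropic k0.
have [code injc c0] : exists2 code : option (F * F) -> {ffun 'I_(2 * k).+1 -> bool},
    injective code & code None = [ffun => false].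
  apply: exists_code; rewrite card_prod cardF -expnD addnn -mul2n.
  by rewrite ltn_exp2l.
have cardS : #|{: {ffun 'I_(2 * k).+1 -> bool}}| = N.
  by rewrite card_ffun card_bool card_ord.
exists ((F * (F * F * F)) * {ffun 'I_(2 * k).+1 -> bool})%type, (adj d code); split.
- exact: adj_sym.
- exact: adj_irr.
- exact: adj_triangle_free.
- by rewrite !card_prod cardS cardF /q; ring.
move=> C D rowD colD; have q0 : 0 < q by rewrite expn_gt0.
have N0 : 0 < N by rewrite expn_gt0.
apply: (edge_count (R := rat) q0 N0 _ _ _ rowD colD); first exact: adj_sym.
- by move=> f; have := qform_adj_ge d two0 injc c0 f; rewrite cardS cardF.
- by move=> f; have := qform_adj_le two0 dP injc c0 f; rewrite cardS cardF.
Qed.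

(** Bernoulli's inequality for [1 + 1 / c], with denominators cleared. *)
Lemma bernoulli c n : c ^ n * (c + n) <= c * c.+1 ^ n.
Proof.
elim: n => [|n IHn]; first by rewrite !expn0 mul1n muln1 addn0.
rewrite !expnS; have [->|c0] := posnP c; first by rewrite !mul0n.
apply: (@leq_trans (c.+1 * (c ^ n * (c + n)))); last first.
  by rewrite [leqRHS]mulnCA leq_mul2l IHn.
by rewrite -mulnA mulnCA [leqRHS]mulnCA leq_mul2l; apply/orP; right; lia.
Qed.

(** Hence [c.+1] steps that each shrink by the factor [1 - 1 / c.+1] at least halve a container. *)
Lemma pred_expn_double c : 2 * c ^ c.+1 <= c.+1 ^ c.+1.
Proof.
have [->|c0] := posnP c; first by [].
rewrite -(leq_pmul2l c0); apply: leq_trans (bernoulli c c.+1).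
rewrite mulnA mulnC leq_mul2l; lia.
Qed.

(** With [q = 2 ^ k] and up to factors depending on [h], the last three inequalities put [n] below
    [q ^ 3], [k] below [q] and [n] above [k ^ 2 * q ^ 2]. They control the pairs in a container, the
    exceptional sets and the number of containers. *)
Lemma exists_sample k n p h :
  0 < k -> 0 < n -> p <= n -> n <= h * p -> h <= k ->
  n * 2 ^ (6 * h + 5) <= 2 ^ (3 * k) -> 3 * k * 2 ^ (3 * h + 5) <= 2 ^ k ->
  (12 * k + 3) * (3 * k * 2 ^ (2 * k + 4)) + 2 <= 2 * n ->
  exists (T : finType) (A : rel T) (f : {ffun 'I_n -> T}),
    [/\ symmetric A, forall x y z, A x y -> A y z -> A x z -> False &
      forall b w : 'I_(3 * p) -> 'I_n, ~ spoiled A f b w].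
Proof.
move=> k0 n0 pn nhp hk c1 c2 c3.
have [T [A [A_sym A_irr A_tf cardT edges]]] := exists_kernel k0.
pose q := 2 ^ k; pose N := 2 ^ (2 * k).+1.
have q0 : 0 < q by rewrite expn_gt0.
have N0 : 0 < N by rewrite expn_gt0.
(* Each block of [16 * q ^ 2] steps halves the container, and [3 * k] halvings bring [#|T| ^ 2]
   below [W]. *)
pose s := 3 * k * 2 ^ (2 * k + 4).
have ET : #|T| = 2 ^ (6 * k + 1).
  by rewrite cardT -expnM -expnD; congr (_ ^ _); lia.
have EW : 16 * q ^ 5 * N ^ 2 = 2 ^ (9 * k + 6).
  by rewrite -[16]/(2 ^ 4) -!expnM -!expnD; congr (_ ^ _); lia.
have EL : 16 * q ^ 3 * N = 2 ^ (5 * k + 5).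
  by rewrite -[16]/(2 ^ 4) -!expnM -!expnD; congr (_ ^ _); lia.
have EB : 16 * q ^ 2 = 2 ^ (2 * k + 4).
  by rewrite -[16]/(2 ^ 4) -!expnM -!expnD; congr (_ ^ _); lia.
have TT : #|T| ^ 2 < 2 ^ (3 * k) * (16 * q ^ 5 * N ^ 2).
  by rewrite ET EW -expnM -expnD ltn_exp2l //; clear -hk; lia.
have TsW : (16 * q ^ 2).-1 ^ s * #|T| ^ 2 < (16 * q ^ 2) ^ s * (16 * q ^ 5 * N ^ 2).
  have B0 : 0 < 16 * q ^ 2 by rewrite EB expn_gt0.
  apply: (@leq_trans ((16 * q ^ 2).-1 ^ s * (2 ^ (3 * k) * (16 * q ^ 5 * N ^ 2)))).
    rewrite ltn_pmul2l // expn_gt0; apply/orP; left.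
    by rewrite EB -subn1 subn_gt0 -[1]/(2 ^ 0) ltn_exp2l // addn4.
  rewrite mulnA leq_mul2r; apply/orP; right; rewrite mulnC.
  have Es : s = 16 * q ^ 2 * (3 * k) by rewrite /s -EB mulnC.
  rewrite Es ![_ ^ (16 * q ^ 2 * _)]expnM -expnMn leq_exp2r ?muln_gt0 //.
  have := pred_expn_double (16 * q ^ 2).-1; rewrite prednK //.
(* This [D] is the largest that [c1] allows for [n * D * 2 ^ (3 * h) <= #|T|]. *)
have WD : 16 * q ^ 5 * N ^ 2 <= 2 ^ (6 * k - 3 * h) * (2 ^ (3 * k + 3 * h + 6)).+1.
  rewrite EW; apply: (@leq_trans (2 ^ (6 * k - 3 * h) * 2 ^ (3 * k + 3 * h + 6))).
    by rewrite -expnD leq_exp2l //; clear -hk; lia.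
  by rewrite leq_mul2l leqnSn orbT.
have [c [cP covP]] := container_family q0 N0 edges TT TsW WD.
pose M := 3 * k * (16 * q ^ 3 * N) + 2 ^ (6 * k - 3 * h).
have [|||||f fP] := exists_unspoiled (c := c) (k := p) (h := h) A_irr (M := M)
  (D := 2 ^ (3 * k + 3 * h + 6)) _ covP n0 _ pn nhp.
- move=> i; have [colD XM YM] := cP i; split=> //.
  exact: leq_trans XM (leq_addr _ _).
- by rewrite ET expn_gt0.
- rewrite -mulnA -expnD ET.
  apply: (@leq_trans (n * 2 ^ (6 * h + 5) * 2 ^ (3 * k + 1))).
    by rewrite -mulnA -expnD leq_mul2l leq_exp2l ?orbT //; clear -hk; lia.
  apply: (@leq_trans (2 ^ (3 * k) * 2 ^ (3 * k + 1))); first by rewrite leq_mul2r c1 orbT.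
  by rewrite -expnD leq_exp2l //; clear -hk; lia.
- rewrite mulnDl -[2 ^ (6 * k - _) * _]expnD EL ET addn1 expnS mul2n -addnn; apply: leq_add.
    apply: (@leq_trans (3 * k * 2 ^ (3 * h + 5) * 2 ^ (5 * k))).
      by rewrite -!mulnA -!expnD !leq_mul2l leq_exp2l ?orbT //; clear -hk; lia.
    apply: (@leq_trans (2 ^ k * 2 ^ (5 * k))); first by rewrite leq_mul2r c2 orbT.
    by rewrite -expnD leq_exp2l //; clear -hk; lia.
  by rewrite leq_exp2l //; clear -hk; lia.
- rewrite card_tuple !card_option card_prod mulnn ET -expnM.
  (* Rounding the factor 3 up to [2 ^ 2] accounts for the [+ 2] in [c3]. *)
  apply: (@leq_trans (2 ^ 2 * (2 ^ (12 * k + 3)) ^ s)).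
    rewrite -[3 * _.+2 ^ s < _]/((3 * _.+2 ^ s).+1 <= _) -addn1.
    apply: (@leq_trans (3 * (2 ^ (12 * k + 3)) ^ s + (2 ^ (12 * k + 3)) ^ s)).
      apply: leq_add; last by rewrite expn_gt0 expn_gt0.
      rewrite leq_mul2l /= leq_exp2r; last by rewrite /s 2!muln_gt0 k0 expn_gt0.
      have -> : 2 ^ (12 * k + 3) = 2 * 2 ^ ((6 * k + 1) * 2).
        by rewrite -expnS; congr (_ ^ _); clear -hk; lia.
      have : 2 ^ 1 <= 2 ^ ((6 * k + 1) * 2) by rewrite leq_exp2l //; clear -hk; lia.
      by rewrite expn1; move: (2 ^ ((6 * k + 1) * 2)) => z; clear; lia.
    by rewrite addnC -mulSn.
  rewrite -expnM -expnD leq_exp2l // addnC; move: c3; rewrite -/s; clear; lia.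
by exists T, A, f; split=> // x y z; apply: A_tf.
Qed.

(** Cubing [k <= 3 * 2 ^ (k %/ 3)] gives [k ^ 3 <= 27 * 2 ^ k]. *)
Lemma expn2_ge_sqr a k : 27 * a <= k -> a * k ^ 2 <= 2 ^ k.
Proof.
move=> ak; rewrite -(leq_pmul2l (isT : 0 < 27)) mulnA.
apply: (@leq_trans (k * k ^ 2)); first by rewrite leq_mul2r ak orbT.
have le3 : k <= 3 * 2 ^ (k %/ 3).
  have : k < (k %/ 3).+1 * 3 by apply: ltn_ceil.
  have := ltn_expl (k %/ 3) (ltnSn 1); lia.
rewrite -expnS; apply: (@leq_trans ((3 * 2 ^ (k %/ 3)) ^ 3)); first by rewrite leq_exp2r.
by rewrite expnMn -expnM leq_mul2l leq_exp2l // leq_divM.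
Qed.

(** Take the least [k] with the upper bound on [n]. Minimality makes [n] at least a constant times
    [2 ^ (3 * k)], which exceeds [k ^ 2 * 2 ^ (2 * k)] by any constant factor once [n] is large. *)
Lemma exists_scale h : exists n0, forall n, n0 <= n -> exists k,
  [/\ 0 < k, h <= k, n * 2 ^ (6 * h + 5) <= 2 ^ (3 * k),
      3 * k * 2 ^ (3 * h + 5) <= 2 ^ k &
      (12 * k + 3) * (3 * k * 2 ^ (2 * k + 4)) + 2 <= 2 * n].
Proof.
pose a := 2 ^ (6 * h + 17); pose K := 27 * a + h + 1.
exists (2 ^ (3 * K)) => n nK; pose H := 2 ^ (6 * h + 5).
have exk : exists k, n * H <= 2 ^ (3 * k).
  exists (n * H); apply: leq_trans (ltnW (ltn_expl _ (ltnSn 1))) _.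
  by rewrite leq_exp2l //; lia.
have [k nHk kmin] := ex_minnP exk; exists k.
have H0 : 0 < H by rewrite expn_gt0.
have Kk : K <= k.
  rewrite -(leq_pmul2l (isT : 0 < 3)) -(leq_exp2l _ _ (ltnSn 1)).
  apply: leq_trans nK _; apply: leq_trans nHk; exact: leq_pmulr.
have ak : 27 * a <= k by apply: leq_trans Kk; rewrite /K; lia.
have k0 : 0 < k by apply: leq_trans Kk; rewrite /K; lia.
have hk : h <= k by apply: leq_trans Kk; rewrite /K; lia.
have k2 := expn2_ge_sqr ak.
have big : 2 ^ (3 * k) <= 8 * (n * H).
  have : 2 ^ (3 * k.-1) <= n * H.
    by rewrite leqNgt; apply/negP => /ltnW /kmin; rewrite leqNgt prednK ?leqnn.
  move=> le; rewrite -[8]/(2 ^ 3); apply: leq_trans (leq_mul (leqnn _) le).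
  by rewrite -expnD leq_exp2l //; lia.
split=> //.
  apply: leq_trans k2; rewrite /a (_ : 6 * h + 17 = (3 * h + 5) + (3 * h + 12)); last lia.
  rewrite (expnD 2 (3 * h + 5)) [leqLHS]mulnC -[leqRHS]mulnA leq_mul2l; apply/orP; right.
  have : 2 ^ 2 <= 2 ^ (3 * h + 12) by rewrite leq_exp2l //; lia.
  by move: (2 ^ (3 * h + 12)) => z hz; rewrite -mulnn mulnA leq_mul2r; apply/orP; right; clear -hz k0; nia.
rewrite -(leq_pmul2l (_ : 0 < 4 * H)); last by rewrite muln_gt0.
apply: (@leq_trans (2 ^ (3 * k))); last by apply: leq_trans big _; lia.
apply: (@leq_trans (a * k ^ 2 * 2 ^ (2 * k))); last first.
  apply: leq_trans (leq_mul k2 (leqnn _)) _; rewrite -expnD leq_exp2l //; lia.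
have -> : a = 2 ^ 12 * H by rewrite /a /H -expnD; congr (_ ^ _); lia.
rewrite [2 ^ (2 * k + 4)]expnD.
have z0 : 0 < 2 ^ (2 * k) by rewrite expn_gt0.
move: (2 ^ (2 * k)) z0 => z z0.
have le : 4 * ((12 * k + 3) * (3 * k * (z * 2 ^ 4)) + 2) <= 2 ^ 12 * (k ^ 2 * z).
  have : (12 * k + 3) * (3 * k * 2 ^ 4) + 2 <= 2 ^ 10 * k ^ 2 by rewrite -mulnn; nia.
  move=> /(leq_mul (leqnn z)); nia.
rewrite [4 * H]mulnC -mulnA; apply: leq_trans (leq_mul (leqnn H) le) _.
by apply/eq_leq; ring.
Qed.

(** Here [n] is about [(3 - 1 / m) * t] and the chromatic number at least [n / 2]; the claim asks
    only for [(3 / 2 - 1 / m) * t], which leaves about [t / (2 * m)] for rounding. *)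
Lemma counterexample (m : nat) : 0 < m ->
  exists t0, forall t, t0 <= t -> exists (n : nat) (e : rel 'I_n),
    [/\ simple_graph e, (3 * m - 2) * t <= 2 * m * chromatic_number e &
        ~ has_odd_minor_K e t].
Proof.
move=> m0; pose h := 45 * m; have [n0 scale] := exists_scale h.
exists (n0 + 15 * m + 15) => t t_large.
(* The choice [n + 15 * p = 3 * t] is the threshold of [no_odd_minor], and [h = 45 * m] makes
   [15 * p] about [t / m]. *)
pose p := (3 * t) %/ h + 1; pose n := 3 * t - 15 * p.
have h0 : 0 < h by rewrite muln_gt0.
have p_le : h * p <= 3 * t + h by rewrite mulnDr muln1 leq_add2r mulnC leq_divM.
have p_ge : 3 * t <= h * p by rewrite [leqRHS]mulnC /p addn1 ltnW // ltn_ceil.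
have pm : 3 * m * (15 * p) <= 3 * t + h.
  by rewrite (_ : 3 * m * (15 * p) = h * p) // /h; ring.
have p15 : 3 * (15 * p) <= 3 * t + 45.
  have : m * (3 * (15 * p)) <= m * (3 * t + 45) by move: pm; rewrite /h; nia.
  by rewrite leq_pmul2l.
have nE : n + 15 * p = 3 * t by rewrite subnK //; lia.
have t30 : n0 + 30 <= t by move: t_large m0; clear; lia.
have n_ge : 2 * t <= n + 15 by move: nE p15; clear; lia.
have [k [k0 hk c1 c2 c3]] := scale n ltac:(move: n_ge t30; clear; lia).
have pn : p <= n by move: n_ge nE t30; clear; lia.
have n_gt0 : 0 < n by move: n_ge t30; clear; lia.
have n_le : n <= h * p by apply: leq_trans p_ge; rewrite -nE leq_addr.
have [T [A [f [A_sym A_tf fP]]]] := exists_sample k0 n_gt0 pn n_le hk c1 c2 c3.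
exists n, (nonadj A f); split; first exact: nonadj_simple.
  have := chromatic_nonadj f A_tf; move: (chromatic_number _) => x nx.
  apply: (@leq_trans (m * n)); last by rewrite [2 * m]mulnC -mulnA leq_mul2l nx orbT.
  have E : m * n + m * (15 * p) = 3 * (m * t) by rewrite -mulnDr nE mulnCA.
  move: pm t_large; rewrite -mulnA mulnBl -mulnA; move: E; rewrite /h; clear.
  by move: (m * n) (m * (15 * p)) (m * t) => a b d; lia.
by apply: no_odd_minor fP _ _; rewrite nE.
Qed.

Local Open Scope ring_scope.

Theorem theorem1p3 :
  (forall (R : realType) (delta : R), 0 < delta ->
    exists t0 : nat, forall t : nat, (t0 <= t)%N ->
      exists (T : finType) (e : rel T),
        [/\ simple_graph e,
            (3 / 2 - delta) * t%:R <= (chromatic_number e)%:R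
          & ~ has_odd_minor_K e t])
  /\
  (exists t0 : nat, forall t : nat, (t0 <= t)%N ->
      exists (T : finType) (e : rel T),
        [/\ simple_graph e, (t <= chromatic_number e)%N
          & ~ has_odd_minor_K e t]).
Proof.
split=> [R delta delta0|]; last first.
  (* For [m = 2] the ratio [(3 * m - 2) / (2 * m)] equals 1. *)
  have [t0 ct] := @counterexample 2 isT; exists t0 => t /ct[n [e [se chi nm]]].
  by exists 'I_n, e; split=> //; rewrite -(leq_pmul2l (isT : (0 < 4)%N)).
(* Then [1 / m < delta], and the ratio [3 / 2 - 1 / m] exceeds [3 / 2 - delta]. *)
pose m := (Num.bound delta^-1).+1.
have m_delta : delta^-1 < m%:R.
  apply: lt_le_trans (archi_boundP _) _; first by rewrite invr_ge0 ltW.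
  by rewrite ler_nat.
have [t0 ct] := @counterexample m isT; exists t0 => t /ct[n [e [se chi nm]]].
exists 'I_n, e; split=> //; move: chi; rewrite -(ler_nat R) !natrM natrB; last by lia.
rewrite natrM; set c : R := (chromatic_number e)%:R; set x : R := m%:R => chi.
have x0 : 0 < x by rewrite ltr0n.
have dx : 1 <= delta * x by rewrite mulrC -ler_pdivrMr ?div1r ?ltW // -lt_pV2 ?invrK.
have t_ge0 : 0 <= t%:R :> R by rewrite ler0n.
rewrite -(ler_pM2l (_ : 0 < 2 * x)) ?mulr_gt0 //.
apply: le_trans chi; have := ler_wpM2r t_ge0 dx; lra.
Qed.
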